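(* Let $\alpha>-1$ and $\beta<\alpha+1$ be real numbers and put $$\psi(x)=\int_0^x t^{-\beta}J_\alpha(t)\,dt\qquad(x>0).$$ (i) If $\psi(x)\ge0$ for all $x>0$, then necessarily $$-\alpha-1<\beta<\alpha+1\quad\text{and}\quad \beta\ge-\frac12.$$ (ii) Let $\mathcal{P}^*$ be the set of $(\alpha,\beta)\in\mathbb{R}^2$ defined by $$\mathcal{P}^*=\left\{\alpha>-1,\ \ \max\left[-\frac12,\ -\frac13(\alpha+1)\right]\le\beta<\alpha+1\right\}.$$ Then $\psi(x)\ge0$ for all $x>0$ for each $(\alpha,\beta)\in\mathcal{P}^*$, and strict positivity ($\psi(x)>0$ for all $x>0$) holds unless $(\alpha,\beta)=(1/2,-1/2)$.
   Context: $J_\alpha$ denotes the Bessel function of the first kind of order $\alpha$. *)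

(* Defs.v *)
From Stdlib Require Import Reals Factorial.
From Coquelicot Require Import Coquelicot.
Open Scope R_scope.

(** Stdlib reals and Coquelicot.  [Rpower] has its usual meaning only at
    positive bases; below it is only ever evaluated there. *)

(** Euler's integral, which converges for [s > 0]. *)
Definition Gamma (s : R) : R :=
  RInt_gen (fun t => Rpower t (s - 1) * exp (- t))
           (at_right 0) (Rbar_locally p_infty).

(** The series defining the Bessel function of the first kind, for order
    [alpha > -1] and argument [x > 0].  For such orders every argument
    [k + alpha + 1] of [Gamma] is positive, so Euler's integral suffices. *)
Definition BesselJ (alpha x : R) : R :=
  Series (fun k : nat =>
    (-1) ^ k / (INR (fact k) * Gamma (INR k + alpha + 1))
    * Rpower (x / 2) (2 * INR k + alpha)).

(** The integral is improper at [0]: the integrand behaves there like a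
    multiple of [t ^ (alpha - beta)], so it converges when
    [beta < alpha + 1] (and [alpha > -1]). *)
Definition psi (alpha beta x : R) : R :=
  RInt_gen (fun t => Rpower t (- beta) * BesselJ alpha t)
           (at_right 0) (at_point x).

Definition Pstar (p : R * R) : Prop :=
  let (alpha, beta) := p in
  -1 < alpha /\
  Rmax (- (1 / 2)) (- (1 / 3) * (alpha + 1)) <= beta < alpha + 1.

(* Main.v *)
Require Import Defs.
From Stdlib Require Import Reals Factorial Lra Lia Psatz.
From Coquelicot Require Import Coquelicot.
Open Scope R_scope.

(** Put [c = alpha + 1], [a = (alpha - beta + 1) / 2] and let [hyp01 c t] be the
    series 0F1(; c; -t), so that [BesselJ alpha x] is a positive multiple of
    [x ^ alpha * hyp01 c (x ^ 2 / 4)].  Termwise integration shows that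
    [psi alpha beta x] is a positive multiple of
    [x ^ (2 a) * phi c a (x ^ 2 / 4)], where [phi c a] is the power series
    solution of [(a + t d/dt) phi = hyp01 c].  The theorem is thus about the
    sign of [phi c a] on the positive half-line.

    Sufficiency.  Let [nu = alpha / 2 + 1 / 4], so [c = 2 nu + 1 / 2], and
    [j_m = hyp01 (m + 1)], the normalized Bessel function of order [m].  There
    is an expansion in squares
      [phi c a (4 t) = sum_n D_n t ^ n j_(nu+n) (t) ^ 2].
    It exists because [a + t d/dt] maps [t ^ n j_m ^ 2], [m = nu + n], to a
    combination of the consecutive products
    [t ^ n j_(m-1) j_m] and [t ^ (n+1) j_m j_(m+1)].  If
      [hyp01 c (4 t) = j_nu (t) ^ 2 + sum_(n >= 1) E_n t ^ n j_(nu+n-1) (t) j_(nu+n) (t)],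
    then the [D_n] are given by a recursion of order one with inhomogeneous
    term [E_n].  The [E_n] with [n >= 2] form a hypergeometric sequence;
    comparing coefficients of [t ^ k], this is a terminating well-poised 3F2
    sum at 1 (a case of Dixon's theorem), proved here by a Wilf-Zeilberger
    pair ([hyp01_coef_products], [phi_coef_squares]).

    The sign of [D_1] is that of [4 nu + 1 - 3 a], which is nonnegative exactly
    when [beta >= - (alpha + 1) / 3].  For [n >= 2] the sign of [E_n] is that of
    [1 - 2 nu].  If [nu <= 1/2], the recursion therefore only adds nonnegative
    terms.  If [nu > 1/2], the [E_n] are negative, but [D_n] is at least an
    explicit positive multiple of [- E_n] as long as [beta >= - 1 / 2]
    ([square_weight_lower_large]); there is equality when [beta = - 1 / 2].
    Away from [(1/2, -1/2)] all [D_n] with [n >= 2] are positive, and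
    [j_(nu+n) (t) > 0] once [n] is large, which gives strict positivity.

    Necessity.  Lowering [a], that is raising [beta], only increases [phi]
    ([phi_monotone]), so one may move [beta] up before looking for a negative
    value.  If [beta <= - alpha - 1], moving to equality makes [phi] a multiple of
    0F1(; alpha + 2; -t), hence of J_(alpha+1), which takes negative values.  If
    [beta < - 1 / 2], write the integrand as [x ^ g u] with [0 < g <= 1 / 2] and
    [u = x ^ (1/2) J_alpha].  Since [u'' = (kappa / x ^ 2 - 1) u], two integrations
    by parts give [- x ^ g u' (x) + O(1)], and [u'] returns above a fixed
    positive constant at arbitrarily large [x], by comparison with a
    rotation in the phase plane ([normal_form_oscillates]). *)

(** * Coefficients of the expansion in squares *)

(** Coefficients of 0F1(; c; -t). *)
Fixpoint hyp01_coef (c : R) (k : nat) : R :=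
  match k with
  | O => 1
  | S k => - / ((c + INR k) * (INR k + 1)) * hyp01_coef c k
  end.

(** Coefficients of the square of 0F1(; m + 1; -t), which is
    1F2(m + 1/2; m + 1, 2 m + 1; -4 t). *)
Fixpoint square_coef (m : R) (i : nat) : R :=
  match i with
  | O => 1
  | S i => - 4 * (m + 1 / 2 + INR i)
      / ((m + 1 + INR i) * (2 * m + 1 + INR i) * (INR i + 1)) * square_coef m i
  end.

(** The coefficient of [t ^ k] in [t ^ n j_(nu+n) (t) ^ 2].  The recursion in [n]
    makes the function total: the factor [INR k - INR n] produces the zeros for
    [n > k], so that sums over [n] may run past [k]. *)
Fixpoint shifted_square_coef (nu : R) (n k : nat) : R :=
  match n with
  | O => square_coef nu k
  | S n => - (INR k - INR n) * (nu + INR n + 1) ^ 2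
      / (2 * nu + INR n + 1 + INR k) * shifted_square_coef nu n k
  end.

(** [E_1].  It departs from the pattern of the later [E_n] because the term of
    index 0 is the square [j_nu ^ 2] and not the product [j_(nu-1) j_nu], whose
    order [nu - 1] may be below -1. *)
Definition product_weight_1 (nu : R) : R := - 6 / ((nu + 1) * (4 * nu + 1)).

(** [product_weight nu p] is [E_(p+2)]. *)
Fixpoint product_weight (nu : R) (p : nat) : R :=
  match p with
  | O => (1 - 2 * nu) / ((4 * nu + 1) * (4 * nu + 3) * (nu + 1) ^ 2 * (nu + 2))
  | S p => (2 * nu + INR p + 1) * (INR p + 3 / 2)
      / ((INR p + 3) * (2 * nu + INR p + 5 / 2) * (nu + INR p + 2) * (nu + INR p + 3))
      * product_weight nu p
  end.

(** [square_weight_S nu a p] is [D_(p+1)]; its recursion expresses that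
    [a + t d/dt] maps the sum of squares to the sum of products. *)
Fixpoint square_weight_S (nu a : R) (p : nat) : R :=
  match p with
  | O => 2 * (4 * nu + 1 - 3 * a) / (a * (a + 1) * (nu + 1) * (4 * nu + 1))
  | S p => (product_weight nu p + (2 * nu + INR p + 1 - a)
      / ((nu + INR p + 1) * (nu + INR p + 2)) * square_weight_S nu a p) / (a + INR p + 2)
  end.

Definition square_weight (nu a : R) (n : nat) : R :=
  match n with O => / a | S p => square_weight_S nu a p end.

Ltac pose_pos_INR :=
  repeat match goal with |- context [INR ?n] =>
    lazymatch goal with H : 0 <= INR n |- _ => fail | _ => pose proof (pos_INR n) end end.

Ltac nonzero := repeat split; pose_pos_INR; try lra; try nra.

Lemma shifted_square_coef_zero nu k p : shifted_square_coef nu (S k + p) k = 0.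
Proof.
induction p as [|p IH].
- rewrite Nat.add_0_r; simpl. replace (INR k - INR k) with 0 by ring. unfold Rdiv; ring.
- rewrite Nat.add_succ_r; cbn [shifted_square_coef]; rewrite IH; ring.
Qed.

(** The recursion in [k] of the previous coefficients, in the multiplied-out
    form that stays true at [k = n - 1], where both sides vanish. *)
Lemma shifted_square_coef_next nu n k : 0 < 4 * nu + 1 ->
  (INR k + 1 - INR n) * (nu + INR k + 1) * (2 * nu + INR n + INR k + 1)
    * shifted_square_coef nu n (S k)
  = - 4 * (nu + INR k + 1 / 2) * shifted_square_coef nu n k.
Proof.
intros h; induction n as [|n IH].
- cbn [shifted_square_coef square_coef]. simpl (INR 0). field. nonzero.
- cbn [shifted_square_coef]. rewrite !S_INR.
  transitivity (- (INR k - INR n) * (nu + INR n + 1) ^ 2 / (2 * nu + INR n + 1 + INR k)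
     * ((INR k + 1 - INR n) * (nu + INR k + 1) * (2 * nu + INR n + INR k + 1)
         * shifted_square_coef nu n (S k))).
  + field. nonzero.
  + rewrite IH. field. nonzero.
Qed.

Lemma square_coef_shift m i : 0 < 4 * m + 1 ->
  square_coef (m + 1) i * (2 * m + 2 + INR i) = - (INR i + 1) * (m + 1) ^ 2 * square_coef m (S i).
Proof.
intros h; induction i as [|i IH].
- simpl. field. lra.
- transitivity (- 4 * (m + 3 / 2 + INR i) / ((m + 2 + INR i) * (INR i + 1))
     * (square_coef (m + 1) i * (2 * m + 2 + INR i)) / (2 * m + 2 + INR i)).
  + cbn [square_coef]. rewrite !S_INR. field. nonzero.
  + rewrite IH. remember (S i) as j. cbn [square_coef]. subst j. rewrite !S_INR. field. nonzero.
Qed.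

(** The totalized coefficients are those of the square, shifted by [n]. *)
Lemma shifted_square_coef_diag nu n i : 0 < 4 * nu + 1 ->
  shifted_square_coef nu n (n + i) = square_coef (nu + INR n) i.
Proof.
intros h; revert i; induction n as [|n IH]; intros i.
- simpl. now rewrite Rplus_0_r.
- replace (S n + i)%nat with (n + S i)%nat by lia.
  cbn [shifted_square_coef]. rewrite IH, S_INR, !plus_INR, S_INR.
  assert (hn : 0 < 4 * (nu + INR n) + 1) by nonzero.
  pose proof (square_coef_shift (nu + INR n) i hn) as H.
  replace (nu + (INR n + 1)) with (nu + INR n + 1) by ring.
  assert (H2 : square_coef (nu + INR n + 1) i
    = - (INR i + 1) * (nu + INR n + 1) ^ 2 * square_coef (nu + INR n) (S i) / (2 * (nu + INR n)
      + 2 + INR i)).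
  { rewrite <- H. field. nonzero. }
  rewrite H2. field. nonzero.
Qed.

(** The coefficient of [t ^ k] in [E_n t ^ n j_(nu+n-1) j_(nu+n)] for
    [n = p + 2], expressed through the one of [t ^ n j_(nu+n) ^ 2]: the two
    hypergeometric series differ by the factor [(2 m + i) / (2 m)], where
    [m = nu + n] and [i = k - n]. *)
Definition product_term (nu : R) (p k : nat) : R :=
  product_weight nu p * shifted_square_coef nu (S (S p)) k * (2 * nu + INR p + 2 + INR k)
    / (2 * (nu + INR p + 2)).

(** The companion of [product_term] in the Wilf-Zeilberger pair.  It is written
    through the term at [S k], so that it vanishes for [p >= k] without a
    pole. *)
Definition wz_mate (nu : R) (p k : nat) : R :=
  - (INR p + 2) * (2 * nu + INR p + 3 / 2) * (2 * nu + INR k + INR p + 2)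
  / (2 * (INR k + nu + 1 / 2)) * product_term nu p (S k).

Lemma product_term_zero nu p k : (k <= S p)%nat -> product_term nu p k = 0.
Proof.
intros h. unfold product_term. replace (S (S p)) with (S k + (S p - k))%nat by lia.
rewrite shifted_square_coef_zero. unfold Rdiv. ring.
Qed.

Lemma product_term_wz nu p k : 0 < 4 * nu + 1 ->
  (INR k + 1) * (2 * nu + 1 / 2 + INR k) * product_term nu p (S k) + 4 * product_term nu p k
  = wz_mate nu (S p) k - wz_mate nu p k.
Proof.
intros h.
assert (H : shifted_square_coef nu (S (S p)) k
  = - (INR k + 1 - (INR p + 2)) * (nu + INR k + 1) * (2 * nu + (INR p + 2) + INR k + 1)
    * shifted_square_coef nu (S (S p)) (S k) / (4 * (nu + INR k + 1 / 2))).
{ pose proof (shifted_square_coef_next nu (S (S p)) k h) as H. rewrite !S_INR in H.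
  replace (INR p + 2) with (INR p + 1 + 1) by ring.
  rewrite !Ropp_mult_distr_l_reverse, H. field. nonzero. }
unfold wz_mate, product_term. rewrite H.
remember (S (S p)) as q. cbn [shifted_square_coef product_weight]. subst q. rewrite !S_INR.
field. nonzero.
Qed.

(** The expansion of [hyp01 c (4 t)] in products, coefficient by coefficient.
    The second summand is [E_1] times the coefficient of [t j_nu j_(nu+1)].
    The induction on [k] sums [product_term_wz] over [p]. *)
Lemma hyp01_coef_products nu k : 0 < 4 * nu + 1 ->
  shifted_square_coef nu 0 k - product_weight_1 nu * INR k * (nu + 1) / 2
    * shifted_square_coef nu 0 k + sum_f_R0 (fun p => product_term nu p k) k
  = 4 ^ k * hyp01_coef (2 * nu + 1 / 2) k.
Proof.
intros h.
induction k as [|k IH].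
- simpl. rewrite product_term_zero by lia. unfold product_weight_1. field. nonzero.
- assert (HS : (INR k + 1) * (2 * nu + 1 / 2 + INR k)
    * sum_f_R0 (fun p => product_term nu p (S k)) (S k)
     + 4 * sum_f_R0 (fun p => product_term nu p k) k = - wz_mate nu 0 k).
  { rewrite tech5, (product_term_zero nu (S k) (S k)), Rplus_0_r by lia.
    rewrite !scal_sum, <- sum_plus.
    rewrite (sum_eq _ (fun p => wz_mate nu (S p) k - wz_mate nu p k)).
    2:{ intros p _. rewrite <- product_term_wz by assumption. ring. }
    assert (tel : forall n, sum_f_R0 (fun p => wz_mate nu (S p) k - wz_mate nu p k) n
      = wz_mate nu (S n) k - wz_mate nu 0 k).
    { induction n as [|n IHn]; [reflexivity|]. rewrite tech5, IHn. ring. }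
    rewrite tel. unfold wz_mate at 1. rewrite product_term_zero by lia. ring. }
  set (S1 := sum_f_R0 _ (S k)) in *. set (S0 := sum_f_R0 _ k) in *.
  assert (E : S1 = (- wz_mate nu 0 k - 4 * S0) / ((INR k + 1) * (2 * nu + 1 / 2 + INR k))).
  { rewrite <- HS. field. nonzero. }
  assert (E0 : S0 = 4 ^ k * hyp01_coef (2 * nu + 1 / 2) k - (shifted_square_coef nu 0 k -
    product_weight_1 nu * INR k * (nu + 1) / 2 * shifted_square_coef nu 0 k)).
  { rewrite <- IH. ring. }
  rewrite E, E0. unfold wz_mate, product_term.
  cbn [shifted_square_coef square_coef hyp01_coef pow product_weight]. rewrite ?S_INR.
  simpl (INR 0). unfold product_weight_1. field. nonzero.
Qed.

Lemma square_weight_S_rec nu a p :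
  square_weight_S nu a (S p) = (product_weight nu p + (2 * nu + INR p + 1 - a)
      / ((nu + INR p + 1) * (nu + INR p + 2)) * square_weight_S nu a p) / (a + INR p + 2).
Proof. reflexivity. Qed.

(** The coefficient of [t ^ k] in that part of [(a + t d/dt) (D_n t ^ n j_(nu+n) ^ 2)],
    [n = p + 1], which falls on the product of index [n + 1]; the recursion of
    the weights is made to cancel it at the next step. *)
Definition telescope_rest (nu a : R) (p k : nat) : R :=
  square_weight_S nu a p * (2 * nu + INR p + 1 - a) / (nu + INR p + 1)
  * ((INR k - INR p - 1) / 2) * shifted_square_coef nu (S p) k.

Lemma square_weight_telescope nu a p k : 0 < 4 * nu + 1 -> 0 < a ->
  (a + INR k) * (square_weight_S nu a (S p) * shifted_square_coef nu (S (S p)) k)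
  = product_term nu p k + telescope_rest nu a (S p) k - telescope_rest nu a p k.
Proof.
intros h ha. unfold telescope_rest, product_term.
remember (S p) as q. cbn [shifted_square_coef]. subst q. cbn [square_weight_S]. rewrite !S_INR.
set (s := shifted_square_coef nu (S p) k). clearbody s. field. nonzero.
Qed.

Lemma square_weight_partial_sum nu a p k : 0 < 4 * nu + 1 -> 0 < a ->
  (a + INR k) * sum_f_R0 (fun n => square_weight nu a n * shifted_square_coef nu n k) (S (S p))
  = shifted_square_coef nu 0 k - product_weight_1 nu * INR k * (nu + 1) / 2
    * shifted_square_coef nu 0 k
    + sum_f_R0 (fun p => product_term nu p k) p + telescope_rest nu a (S p) k.
Proof.
intros h ha; induction p as [|p IH].
- rewrite tech5, Rmult_plus_distr_l. cbn [square_weight].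
  rewrite square_weight_telescope by assumption.
  simpl sum_f_R0. unfold telescope_rest at 2. cbn [shifted_square_coef square_weight
    square_weight_S]. unfold product_weight_1. simpl (INR 0).
  field. nonzero.
- rewrite tech5, Rmult_plus_distr_l, IH. cbn [square_weight].
  rewrite square_weight_telescope by assumption.
  rewrite tech5. ring.
Qed.

(** Both the rest of the telescoping sum and the terms of index above [k] vanish, so
    the expansion of [phi] in squares is a finite identity for each
    coefficient. *)
Lemma phi_coef_squares nu a k : 0 < 4 * nu + 1 -> 0 < a ->
  sum_f_R0 (fun n => square_weight nu a n * shifted_square_coef nu n k) k
    = 4 ^ k * (hyp01_coef (2 * nu + 1 / 2) k / (a + INR k)).
Proof.
intros h ha.
pose proof (square_weight_partial_sum nu a k k h ha) as H.
rewrite hyp01_coef_products in H by assumption.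
unfold telescope_rest in H. replace (S (S k)) with (S k + 1)%nat in H at 2 by lia.
rewrite shifted_square_coef_zero, Rmult_0_r, Rplus_0_r in H.
assert (H' : sum_f_R0 (fun n => square_weight nu a n * shifted_square_coef nu n k) k
  = sum_f_R0 (fun n => square_weight nu a n * shifted_square_coef nu n k) (S (S k))).
{ rewrite !tech5.
  replace (S (S k)) with (S k + 1)%nat by lia. rewrite shifted_square_coef_zero.
  replace (S k) with (S k + 0)%nat at 2 by lia. rewrite shifted_square_coef_zero. ring. }
rewrite H'. apply Rmult_eq_reg_l with (a + INR k); [|pose_pos_INR; lra].
rewrite H. field. nonzero.
Qed.

(** * Signs and sizes of the weights *)

Lemma product_weight_sign nu p : 0 < 4 * nu + 1 ->
  exists r, 0 < r /\ product_weight nu p = (1 - 2 * nu) * r.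
Proof.
intros h; induction p as [|p (r & hr & IH)].
- exists (/ ((4 * nu + 1) * (4 * nu + 3) * (nu + 1) ^ 2 * (nu + 2))). split.
  + apply Rinv_0_lt_compat. repeat apply Rmult_lt_0_compat; lra.
  + simpl. field. lra.
- exists ((2 * nu + INR p + 1) * (INR p + 3 / 2)
      / ((INR p + 3) * (2 * nu + INR p + 5 / 2) * (nu + INR p + 2) * (nu + INR p + 3)) * r).
  pose_pos_INR. split.
  + apply Rmult_lt_0_compat; [apply Rdiv_lt_0_compat|assumption];
    repeat apply Rmult_lt_0_compat; lra.
  + cbn [product_weight]. rewrite IH. field. nonzero.
Qed.

Lemma square_weight_1_nonneg nu a : 0 < 4 * nu + 1 -> 0 < a -> 3 * a <= 4 * nu + 1 ->
  0 <= square_weight_S nu a 0.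
Proof.
intros h ha h3. simpl. apply Rdiv_le_0_compat; [lra|].
repeat apply Rmult_lt_0_compat; lra.
Qed.

Lemma square_weight_nonneg_small nu a p : 0 < 4 * nu + 1 -> 0 < a -> nu <= 1 / 2 ->
  3 * a <= 4 * nu + 1 -> 0 <= square_weight_S nu a p.
Proof.
intros h ha hn h3; induction p as [|p IH].
- now apply square_weight_1_nonneg.
- destruct (product_weight_sign nu p h) as (r & hr & Hr). cbn [square_weight_S]. rewrite Hr.
  pose_pos_INR.
  apply Rdiv_le_0_compat; [|lra].
  apply Rplus_le_le_0_compat; [apply Rmult_le_pos; lra|].
  apply Rmult_le_pos; [|assumption].
  apply Rdiv_le_0_compat; [lra|]. apply Rmult_lt_0_compat; lra.
Qed.

Lemma square_weight_pos_small nu a p : 0 < 4 * nu + 1 -> 0 < a -> nu <= 1 / 2 ->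
  3 * a <= 4 * nu + 1 -> (nu < 1 / 2 \/ 3 * a < 4 * nu + 1) -> 0 < square_weight_S nu a (S p).
Proof.
intros h ha hn h3 hs.
assert (step : forall q, 0 < (2 * nu + INR q + 1 - a) / ((nu + INR q + 1) * (nu + INR q + 2))).
{ intros q. pose_pos_INR. apply Rdiv_lt_0_compat; [lra|]. apply Rmult_lt_0_compat; lra. }
destruct (Rlt_or_le nu (1 / 2)) as [hl|hl].
- destruct (product_weight_sign nu p h) as (r & hr & Hr). cbn [square_weight_S]. rewrite Hr.
  pose_pos_INR.
  apply Rdiv_lt_0_compat; [|lra].
  apply Rplus_lt_le_0_compat; [apply Rmult_lt_0_compat; lra|].
  apply Rmult_le_pos; [apply Rlt_le, step | now apply square_weight_nonneg_small].
- assert (Hp : forall q, 0 < square_weight_S nu a q); [|apply Hp].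
  induction q as [|q IH].
  + simpl. apply Rdiv_lt_0_compat; [lra|]. repeat apply Rmult_lt_0_compat; lra.
  + destruct (product_weight_sign nu q h) as (r & hr & Hr). cbn [square_weight_S]. rewrite Hr.
    pose_pos_INR.
    apply Rdiv_lt_0_compat; [|lra].
    apply Rplus_le_lt_0_compat; [apply Rmult_le_pos; lra|].
    apply Rmult_lt_0_compat; [apply step | exact IH].
Qed.

Lemma Rle_div_intro x y z : 0 < z -> x * z <= y -> x <= y / z.
Proof. intros hz hxy. now apply Rle_div_r. Qed.

(** The quotient [D_n / - E_n], [n = p + 2], in the extremal case
    [a = nu + 1 / 2], that is [beta = - 1 / 2], where [D_n] has a closed form. *)
Definition weight_ratio (nu : R) (p : nat) : R :=
  4 * (INR p + 2 * nu + 1) * (INR p + 3 / 2)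
  / ((2 * nu + 2 * INR p + 5) * (2 * nu + 2 * INR p + 3)).

(** The recursion of the weights in the extremal case [a = nu + 1 / 2]: it says
    that [- E_n weight_ratio] solves it. *)
Lemma weight_ratio_step nu p : 1 / 2 < nu ->
  product_weight nu (S p) - product_weight nu p * weight_ratio nu p * (nu + INR p
    + 3 / 2) / ((nu + INR p + 2) * (nu + INR p + 3))
  = - (nu + INR p + 7 / 2) * product_weight nu (S p) * weight_ratio nu (S p).
Proof.
intros h. unfold weight_ratio. cbn [product_weight]. rewrite S_INR. field. nonzero.
Qed.

(** When [a] decreases, the factor [2 nu + n - a] of the recursion increases
    and its divisor [a + n + 1] decreases, so the weights are smallest in the
    extremal case [a = nu + 1 / 2], where equality holds. *)
Lemma square_weight_lower_large nu a p : 1 / 2 < nu -> 0 < a -> a <= nu + 1 / 2 ->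
  - product_weight nu p * weight_ratio nu p <= square_weight_S nu a (S p).
Proof.
intros h ha hn.
assert (hE : forall q, product_weight nu q < 0).
{ intros q. destruct (product_weight_sign nu q) as (r & hr & ->); [lra|nra]. }
assert (hth : forall q, 0 < weight_ratio nu q).
{ intros q. unfold weight_ratio. pose_pos_INR. apply Rdiv_lt_0_compat;
    repeat apply Rmult_lt_0_compat; lra. }
induction p as [|p IH].
- set (d := (2 * nu - 1) / ((nu + 1 / 2) * (nu + 3 / 2) * (nu + 1) * (4 * nu + 1))).
  assert (hd : d <= square_weight_S nu a 0).
  { unfold d; simpl. unfold Rdiv. apply Rmult_le_compat; [lra| |lra|].
    - apply Rlt_le, Rinv_0_lt_compat; repeat apply Rmult_lt_0_compat; lra.
    - apply Rinv_le_contravar; [repeat apply Rmult_lt_0_compat; lra|].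
      repeat apply Rmult_le_compat_r; try lra.
      apply Rmult_le_compat; lra. }
  assert (hd0 : 0 < d).
  { unfold d. apply Rdiv_lt_0_compat; repeat apply Rmult_lt_0_compat; lra. }
  rewrite square_weight_S_rec. simpl (INR 0).
  apply Rle_div_intro; [lra|].
  apply Rle_trans with (product_weight nu 0 + (nu + 1 / 2) / ((nu + 1) * (nu + 2)) * d).
  + apply Rle_trans with (- product_weight nu 0 * weight_ratio nu 0 * (nu + 5 / 2)).
    * apply Rmult_le_compat_l; [|lra].
      specialize (hE O); specialize (hth O); nra.
    * right. unfold d, weight_ratio. simpl. field. repeat split; lra.
  + apply Rplus_le_compat_l. apply Rmult_le_compat; [| lra | | exact hd].
    * apply Rdiv_le_0_compat; [lra|nra].
    * rewrite !Rplus_0_r. apply Rmult_le_compat_r; [|lra].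
      apply Rlt_le, Rinv_0_lt_compat; nra.
- rewrite square_weight_S_rec, S_INR. pose_pos_INR. apply Rle_div_intro; [lra|].
  apply Rle_trans with (- (nu + INR p + 7 / 2) * product_weight nu (S p) * weight_ratio nu (S p)).
  + specialize (hE (S p)); specialize (hth (S p)).
    assert (0 < - product_weight nu (S p) * weight_ratio nu (S p)) by nra. nra.
  + rewrite <- weight_ratio_step by assumption. unfold Rminus. apply Rplus_le_compat_l.
    replace (- (product_weight nu p * weight_ratio nu p * (nu + INR p + 3 / 2) / ((nu + INR p
      + 2) * (nu + INR p + 3))))
      with ((nu + INR p + 3 / 2) / ((nu + INR p + 2) * (nu + INR p + 3))
        * (- product_weight nu p * weight_ratio nu p))
      by (field; lra).
    specialize (hE p); specialize (hth p).
    apply Rmult_le_compat; try nra.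
    * apply Rdiv_le_0_compat; [lra|nra].
    * replace (nu + (INR p + 1) + 1) with (nu + INR p + 2) by ring.
      replace (nu + (INR p + 1) + 2) with (nu + INR p + 3) by ring.
      apply Rmult_le_compat_r; [|lra].
      apply Rlt_le, Rinv_0_lt_compat; nra.
Qed.

(** The set [Pstar] in the parameters [nu = alpha / 2 + 1 / 4] and
    [a = (alpha - beta + 1) / 2]. *)
Definition positivity_region (nu a : R) : Prop :=
  0 < 4 * nu + 1 /\ 0 < a /\ 3 * a <= 4 * nu + 1 /\ a <= nu + 1 / 2.

Lemma square_weight_nonneg nu a n : positivity_region nu a -> 0 <= square_weight nu a n.
Proof.
intros (h & ha & h3 & h4). destruct n as [|p].
- simpl. apply Rlt_le, Rinv_0_lt_compat, ha.
- cbn [square_weight]. destruct (Rlt_or_le (1 / 2) nu) as [hl|hl].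
  + destruct p as [|p]; [now apply square_weight_1_nonneg|].
    eapply Rle_trans; [|now apply square_weight_lower_large].
    destruct (product_weight_sign nu p h) as (r & hr & ->).
    apply Rmult_le_pos; [nra|]. unfold weight_ratio. pose_pos_INR.
    apply Rdiv_le_0_compat; [|nra]. repeat apply Rmult_le_pos; lra.
  + now apply square_weight_nonneg_small.
Qed.

(** The excluded point is [(alpha, beta) = (1/2, -1/2)], where [phi] is the
    first square alone, a multiple of [(sin (x / 2) / x) ^ 2]. *)
Lemma square_weight_pos nu a p : positivity_region nu a -> ~ (nu = 1 / 2 /\ a = 1) ->
  0 < square_weight nu a (S (S p)).
Proof.
intros (h & ha & h3 & h4) hne. cbn [square_weight].
destruct (Rlt_or_le (1 / 2) nu) as [hl|hl].
- eapply Rlt_le_trans; [|now apply square_weight_lower_large].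
  destruct (product_weight_sign nu p h) as (r & hr & ->).
  apply Rmult_lt_0_compat; [nra|]. unfold weight_ratio. pose_pos_INR.
  apply Rdiv_lt_0_compat; [|nra]. repeat apply Rmult_lt_0_compat; lra.
- apply square_weight_pos_small; try assumption.
  destruct (Req_dec nu (1 / 2)) as [e|e]; [|left; lra].
  right. destruct (Req_dec a 1) as [e'|e']; [now elim hne|lra].
Qed.

(** * Power series with factorially decaying coefficients *)

Definition factorial_decay (a : nat -> R) : Prop :=
  exists K M, 0 <= K /\ 0 <= M /\ forall k, Rabs (a k) <= K * (M ^ k / INR (fact k)).

Lemma ex_series_exp K M : ex_series (fun k => K * (M ^ k / INR (fact k))).
Proof.
apply (ex_series_scal_l K (fun k => M ^ k / INR (fact k))). exists (exp M).
eapply is_series_ext; [|apply (is_exp_Reals M)].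
intros n. simpl. rewrite pow_n_pow. unfold scal; simpl; unfold mult; simpl. reflexivity.
Qed.

Lemma decay_ex_series_abs a x : factorial_decay a -> ex_series (fun k => Rabs (a k * x ^ k)).
Proof.
intros (K & M & hK & hM & H).
apply (ex_series_le (fun k => Rabs (a k * x ^ k)) (fun k => K * ((M * Rabs x) ^ k / INR (fact k)))).
- intros k. unfold norm; simpl; unfold abs; simpl. rewrite Rabs_Rabsolu, Rabs_mult, <- RPow_abs,
    Rpow_mult_distr.
  replace (K * (M ^ k * Rabs x ^ k / INR (fact k))) with (K * (M ^ k / INR (fact k)) * Rabs x ^ k).
  + apply Rmult_le_compat_r; [apply pow_le, Rabs_pos | apply H].
  + field. apply INR_fact_neq_0.
- apply ex_series_exp.
Qed.

Lemma decay_radius a x : factorial_decay a -> Rbar_lt (Rabs x) (CV_radius a).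
Proof.
intros H. apply Rbar_lt_le_trans with (Rabs x + 1); [simpl; lra|].
apply (proj1 (Lub_Rbar_correct (CV_disk a))). unfold CV_disk. now apply decay_ex_series_abs.
Qed.

Lemma decay_ex_pseries a x : factorial_decay a -> ex_pseries a x.
Proof. intros H. apply CV_radius_inside. now apply decay_radius. Qed.

Lemma decay_by_ratio (a : nat -> R) (M : R) : 0 <= M ->
  (forall k, Rabs (a (S k)) <= M / (INR k + 1) * Rabs (a k)) -> factorial_decay a.
Proof.
intros hM H. exists (Rabs (a O)), M. repeat split; auto using Rabs_pos.
induction k as [|k IH].
- simpl. lra.
- eapply Rle_trans; [apply H|]. pose proof (pos_INR k).
  apply Rle_trans with (M / (INR k + 1) * (Rabs (a O) * (M ^ k / INR (fact k)))).
  + apply Rmult_le_compat_l; [apply Rdiv_le_0_compat; lra | exact IH].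
  + right. rewrite fact_simpl, mult_INR, S_INR. simpl. field. split; [apply INR_fact_neq_0|lra].
Qed.

Lemma hyp01_coef_decay c : 0 < c -> factorial_decay (hyp01_coef c).
Proof.
intros hc. apply decay_by_ratio with (/ c).
- apply Rlt_le, Rinv_0_lt_compat, hc.
- intros k. cbn [hyp01_coef]. rewrite Rabs_mult. apply Rmult_le_compat_r; [apply Rabs_pos|].
  pose proof (pos_INR k). rewrite Rabs_Ropp, Rabs_pos_eq.
  + unfold Rdiv. rewrite <- Rinv_mult. apply Rinv_le_contravar; [nra|].
    apply Rmult_le_compat_r; lra.
  + apply Rlt_le, Rinv_0_lt_compat. nra.
Qed.

Lemma square_coef_bound m i : 0 < 4 * m + 1 -> Rabs (square_coef m i) <= 8 ^ i / INR (fact i).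
Proof.
intros hm. induction i as [|i IH].
- simpl. rewrite Rabs_R1. lra.
- cbn [square_coef]. rewrite Rabs_mult. pose proof (pos_INR i).
  replace (8 ^ S i / INR (fact (S i))) with (8 / (INR i + 1) * (8 ^ i / INR (fact i))).
  2:{ rewrite fact_simpl, mult_INR, S_INR. simpl. field. split; [apply INR_fact_neq_0|lra]. }
  apply Rmult_le_compat; try apply Rabs_pos; [|exact IH].
  replace (- 4 * (m + 1 / 2 + INR i) / ((m + 1 + INR i) * (2 * m + 1 + INR i) * (INR i + 1)))
    with (- (4 * (m + 1 / 2 + INR i) / ((m + 1 + INR i) * (2 * m + 1 + INR i) * (INR i + 1))))
    by (field; lra).
  rewrite Rabs_Ropp, Rabs_pos_eq.
  + apply Rle_div_l; [repeat apply Rmult_lt_0_compat; lra|].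
    replace (8 / (INR i + 1) * ((m + 1 + INR i) * (2 * m + 1 + INR i) * (INR i + 1)))
      with (8 * (m + 1 + INR i) * (2 * m + 1 + INR i)) by (field; lra).
    nra.
  + apply Rdiv_le_0_compat; [lra|repeat apply Rmult_lt_0_compat; lra].
Qed.

(** * The square of a Bessel series *)

(** The binomial coefficient with real upper argument. *)
Fixpoint rbinom (X : R) (k : nat) : R :=
  match k with O => 1 | S k => (X - INR k) / (INR k + 1) * rbinom X k end.

Lemma rbinom_rec X k : (INR k + 1) * rbinom X (S k) = (X - INR k) * rbinom X k.
Proof. cbn [rbinom]. pose proof (pos_INR k). field. lra. Qed.

(** Multiplying by [k + 1 = p + (k + 1 - p)] and absorbing each factor into one of
    the two binomials raises [k] by one on both sides. *)
Lemma vandermonde X Y k :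
  sum_f_R0 (fun p => rbinom X p * rbinom Y (k - p)) k = rbinom (X + Y) k.
Proof.
induction k as [|k IH].
- simpl. ring.
- apply Rmult_eq_reg_l with (INR k + 1); [|pose proof (pos_INR k); lra].
  rewrite rbinom_rec, <- IH.
  transitivity (sum_f_R0 (fun p => INR p * rbinom X p * rbinom Y (S k - p)) (S k)
     + sum_f_R0 (fun p => rbinom X p * (INR (S k - p) * rbinom Y (S k - p))) (S k)).
  + rewrite <- sum_plus, scal_sum. apply sum_eq. intros p hp.
    rewrite minus_INR, S_INR by lia. ring.
  + rewrite (decomp_sum (fun p => INR p * _ * _)) by lia. simpl (INR 0).
    rewrite !Rmult_0_l, Rplus_0_l. simpl pred.
    rewrite (tech5 (fun p => rbinom X p * _)), Nat.sub_diag. simpl (INR 0).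
    rewrite Rmult_0_l, Rmult_0_r, Rplus_0_r, <- sum_plus, scal_sum.
    apply sum_eq. intros p hp.
    replace (S k - S p)%nat with (k - p)%nat by lia.
    replace (S k - p)%nat with (S (k - p)) by lia.
    rewrite !S_INR, !rbinom_rec, minus_INR by lia. ring.
Qed.

Lemma rbinom_shift X k : (INR k + 1) * rbinom (X + 1) (S k) = (X + 1) * rbinom X k.
Proof.
induction k as [|k IH].
- simpl. field.
- rewrite rbinom_rec. pose proof (pos_INR k).
  apply Rmult_eq_reg_l with (INR k + 1); [|lra].
  replace ((INR k + 1) * ((X + 1 - INR (S k)) * rbinom (X + 1) (S k)))
    with ((X + 1 - INR (S k)) * ((INR k + 1) * rbinom (X + 1) (S k))) by ring.
  rewrite IH, S_INR.
  replace ((INR k + 1) * ((X + 1) * rbinom X (S k)))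
    with ((X + 1) * ((INR k + 1) * rbinom X (S k))) by ring.
  rewrite rbinom_rec. ring.
Qed.

(** Up to a factor depending on [i] only, the coefficients of index [p <= i] are
    binomials with the fixed upper argument [m + i]; this turns the Cauchy
    square into a Vandermonde sum. *)
Lemma hyp01_coef_rbinom m p i : -1 < m -> (p <= i)%nat ->
  hyp01_coef (m + 1) p * (-1) ^ p * INR (fact p) * (INR (fact i) * rbinom (m + INR i) i)
  = INR (fact (i - p)) * rbinom (m + INR i) (i - p).
Proof.
intros hm; induction p as [|p IH]; intros hp.
- rewrite Nat.sub_0_r. simpl. ring.
- assert (IH' := IH ltac:(lia)). pose proof (pos_INR p).
  replace (i - p)%nat with (S (i - S p)) in IH' by lia.
  rewrite !fact_simpl, !mult_INR in *.
  apply Rmult_eq_reg_l with (m + 1 + INR p); [|lra].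
  transitivity (hyp01_coef (m + 1) p * (-1) ^ p * INR (fact p) * (INR (fact i) * rbinom (m
    + INR i) i)).
  + cbn [hyp01_coef pow]. rewrite S_INR. field. lra.
  + rewrite IH', S_INR.
    replace ((INR (i - S p) + 1) * INR (fact (i - S p)) * rbinom (m + INR i) (S (i - S p)))
      with (INR (fact (i - S p)) * ((INR (i - S p) + 1) * rbinom (m + INR i) (S (i - S p))))
        by ring.
    rewrite rbinom_rec, minus_INR, S_INR by lia. ring.
Qed.

Lemma rbinom_pos m i : -1 < m -> 0 < rbinom (m + INR i) i.
Proof.
intros hm; induction i as [|i IH].
- simpl. lra.
- pose proof (pos_INR i). rewrite S_INR, <- Rplus_assoc.
  apply Rmult_lt_reg_l with (INR i + 1); [lra|]. rewrite rbinom_shift, Rmult_0_r. nra.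
Qed.

Lemma square_coef_rbinom m i : 0 < 4 * m + 1 ->
  square_coef m i * (-1) ^ i * (INR (fact i) * rbinom (m + INR i) i) ^ 2
    = rbinom (2 * (m + INR i)) i.
Proof.
intros hm; induction i as [|i IH].
- simpl. ring.
- pose proof (pos_INR i).
  assert (H1 : rbinom (m + INR (S i)) (S i) = (m + INR i + 1) * rbinom (m + INR i) i / (INR i + 1)).
  { rewrite S_INR, <- Rplus_assoc, <- rbinom_shift. field. lra. }
  assert (H2 : rbinom (2 * (m + INR i) + 1) i
     = (2 * (m + INR i) + 1) * rbinom (2 * (m + INR i)) i / (2 * (m + INR i) + 1 - INR i)).
  { rewrite <- rbinom_shift, rbinom_rec. field. lra. }
  replace (2 * (m + INR (S i))) with (2 * (m + INR i) + 1 + 1) by (rewrite S_INR; ring).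
  apply Rmult_eq_reg_l with (INR i + 1); [|lra].
  rewrite rbinom_shift, H2, <- IH, H1, fact_simpl, mult_INR, S_INR. cbn [square_coef pow].
  field. lra.
Qed.

Lemma hyp01_coef_square m i : 0 < 4 * m + 1 ->
  PS_mult (hyp01_coef (m + 1)) (hyp01_coef (m + 1)) i = square_coef m i.
Proof.
intros hm. assert (hm1 : -1 < m) by lra.
pose proof (rbinom_pos m i hm1) as hr. pose proof (INR_fact_lt_0 i) as hf.
assert (hX : (INR (fact i) * rbinom (m + INR i) i) ^ 2 <> 0).
{ apply pow_nonzero. apply Rmult_integral_contrapositive_currified; lra. }
assert (h1 : (-1) ^ i <> 0) by (apply pow_nonzero; lra).
apply Rmult_eq_reg_r with ((-1) ^ i * (INR (fact i) * rbinom (m + INR i) i) ^ 2).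
2:{ now apply Rmult_integral_contrapositive_currified. }
rewrite <- Rmult_assoc, <- Rmult_assoc, square_coef_rbinom by assumption.
replace (2 * (m + INR i)) with (m + INR i + (m + INR i)) by ring.
rewrite <- (vandermonde (m + INR i) (m + INR i)). unfold PS_mult.
rewrite Rmult_assoc, Rmult_comm, scal_sum. apply sum_eq. intros p hp.
pose proof (hyp01_coef_rbinom m p i hm1 hp) as Ha.
pose proof (hyp01_coef_rbinom m (i - p) i hm1 ltac:(lia)) as Hb.
replace (i - (i - p))%nat with p in Hb by lia.
apply Rmult_eq_reg_l with (INR (fact p) * INR (fact (i - p))).
2:{ apply Rmult_integral_contrapositive_currified; apply INR_fact_neq_0. }
transitivity (INR (fact (i - p)) * rbinom (m + INR i) (i - p) * (INR (fact p) * rbinom (m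
  + INR i) p)); [|ring].
rewrite <- Ha, <- Hb.
replace ((-1) ^ i) with ((-1) ^ p * (-1) ^ (i - p)) by (rewrite <- pow_add; f_equal; lia).
ring.
Qed.

(** * The sum of squares *)

Lemma pseries_term (x y : R) (k : nat) : scal (pow_n x k) y = x ^ k * y.
Proof. now rewrite pow_n_pow. Qed.

Definition hyp01 (c t : R) : R := PSeries (hyp01_coef c) t.

Definition phi_coef (c a : R) (k : nat) : R := hyp01_coef c k / (a + INR k).

Lemma phi_coef_decay c a : 0 < c -> 0 < a -> factorial_decay (phi_coef c a).
Proof.
intros hc ha. destruct (hyp01_coef_decay c hc) as (K & M & hK & hM & H).
exists (K / a), M. split; [now apply Rdiv_le_0_compat|]. split; [exact hM|].
intros k. pose proof (pos_INR k). pose proof (INR_fact_lt_0 k).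
assert (hX : 0 <= M ^ k / INR (fact k)) by (apply Rdiv_le_0_compat; [now apply pow_le|lra]).
unfold phi_coef. unfold Rdiv at 1. rewrite Rabs_mult, (Rabs_pos_eq (/ _)).
2:{ apply Rlt_le, Rinv_0_lt_compat; lra. }
replace (K / a * (M ^ k / INR (fact k))) with (K * (M ^ k / INR (fact k)) * / a) by (field; lra).
apply Rmult_le_compat; try apply Rabs_pos; auto.
- apply Rlt_le, Rinv_0_lt_compat; lra.
- apply Rinv_le_contravar; lra.
Qed.

Definition phi (c a t : R) : R := PSeries (phi_coef c a) t.

Lemma hyp01_square nu n t : 0 < 4 * nu + 1 ->
  is_pseries (shifted_square_coef nu n) t (t ^ n * hyp01 (nu + INR n + 1) t ^ 2).
Proof.
intros h. pose proof (pos_INR n).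
assert (hm : 0 < 4 * (nu + INR n) + 1) by lra.
assert (hj : factorial_decay (hyp01_coef (nu + INR n + 1))) by (apply hyp01_coef_decay; lra).
assert (H1 : is_pseries (square_coef (nu + INR n)) t (hyp01 (nu + INR n + 1) t ^ 2)).
{ replace (hyp01 (nu + INR n + 1) t ^ 2)
    with (hyp01 (nu + INR n + 1) t * hyp01 (nu + INR n + 1) t) by ring.
  eapply is_pseries_ext; [intros i; apply hyp01_coef_square, hm|].
  apply is_pseries_mult; try (now apply decay_radius);
  apply PSeries_correct; now apply decay_ex_pseries. }
apply (is_pseries_incr_n _ n) in H1.
rewrite pow_n_pow in H1.
eapply is_pseries_ext; [|exact H1].
intros k. rewrite PS_incr_n_simplify.
destruct (Compare_dec.le_lt_dec n k) as [hk|hk].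
- rewrite <- shifted_square_coef_diag by assumption. f_equal. lia.
- replace n with (S k + (n - S k))%nat by lia. now rewrite shifted_square_coef_zero.
Qed.

Definition square_sum (nu a : R) (N : nat) (t : R) : R :=
  sum_f_R0 (fun n => square_weight nu a n * (t ^ n * hyp01 (nu + INR n + 1) t ^ 2)) N.

Lemma square_sum_series nu a N t : 0 < 4 * nu + 1 ->
  is_pseries (fun k => sum_f_R0 (fun n => square_weight nu a n
    * shifted_square_coef nu n k) N) t (square_sum nu a N t).
Proof.
intros h. unfold square_sum. induction N as [|N IH].
- cbn [sum_f_R0].
  apply (is_pseries_scal (square_weight nu a 0) (shifted_square_coef nu 0) t); [apply Rmult_comm|].
  now apply hyp01_square.
- cbn [sum_f_R0]. apply (is_pseries_plus _ (fun k => square_weight nu a (S N)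
    * shifted_square_coef nu (S N) k)); [exact IH|].
  apply (is_pseries_scal (square_weight nu a (S N)) (shifted_square_coef nu (S N)) t);
    [apply Rmult_comm|].
  now apply hyp01_square.
Qed.

Lemma product_weight_bound nu p : 0 < 4 * nu + 1 ->
  Rabs (product_weight nu p) <= Rabs (product_weight nu 0) / INR (fact (S p)).
Proof.
intros h; induction p as [|p IH].
- simpl. lra.
- pose proof (pos_INR p). rewrite fact_simpl, mult_INR, !S_INR.
  set (r := (2 * nu + INR p + 1) * (INR p + 3 / 2)
      / ((INR p + 3) * (2 * nu + INR p + 5 / 2) * (nu + INR p + 2) * (nu + INR p + 3))).
  change (product_weight nu (S p)) with (r * product_weight nu p).
  assert (hr : 0 <= r <= / (INR p + 1 + 1)).
  { unfold r. split.
    - apply Rdiv_le_0_compat; [apply Rmult_le_pos; lra|repeat apply Rmult_lt_0_compat; lra].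
    - apply Rle_div_l; [repeat apply Rmult_lt_0_compat; lra|].
      replace (/ (INR p + 1 + 1) * ((INR p + 3) * (2 * nu + INR p + 5 / 2) * (nu + INR p + 2)
        * (nu + INR p + 3)))
        with ((2 * nu + INR p + 5 / 2) * (nu + INR p + 2) * ((INR p + 3) / (INR p + 2) * (nu
          + INR p + 3))) by (field; lra).
      assert (1 <= (INR p + 3) / (INR p + 2) * (nu + INR p + 3)).
      { apply Rle_trans with (1 * 1); [lra|]. apply Rmult_le_compat; try lra.
        apply Rle_div_r; lra. }
      apply Rle_trans with ((2 * nu + INR p + 5 / 2) * (nu + INR p + 2) * 1); [nra|].
      apply Rmult_le_compat_l; [nra|assumption]. }
  rewrite Rabs_mult, (Rabs_pos_eq r) by apply hr.
  replace (Rabs (product_weight nu 0) / ((INR p + 1 + 1) * INR (fact (S p))))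
    with (/ (INR p + 1 + 1) * (Rabs (product_weight nu 0) / INR (fact (S p)))).
  2:{ field. split; [apply INR_fact_neq_0|lra]. }
  apply Rmult_le_compat; auto using Rabs_pos; apply hr.
Qed.

(** The constant 3 leaves room for both summands of the recursion: the factor
    of [D_n] in [(a + n + 1) D_(n+1)] is at most 2, and [E_(n+1)] is at most
    [K / n!]. *)
Lemma square_weight_bound nu a : positivity_region nu a ->
  exists K, 0 <= K /\ forall n, square_weight nu a n <= K * (3 ^ n / INR (fact n)).
Proof.
intros hg. pose proof hg as (h & ha & h3 & h4).
pose proof (square_weight_nonneg nu a 0 hg) as h0. pose proof (square_weight_nonneg nu a 1 hg) as
  h1.
pose proof (Rabs_pos (product_weight nu 0)) as hE.
(* The first two weights are not produced by the recursion, hence their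
   presence in the constant. *)
exists (square_weight nu a 0 + square_weight nu a 1 + Rabs (product_weight nu 0)). split; [lra|].
set (K := square_weight nu a 0 + square_weight nu a 1 + Rabs (product_weight nu 0)).
assert (hK : 0 <= K) by (unfold K; lra).
intros [|p]; [unfold K; simpl (3 ^ 0); simpl (INR (fact 0)); lra|].
induction p as [|p IH].
- unfold K. simpl (3 ^ 1); simpl (INR (fact 1)). lra.
- change (square_weight nu a (S (S p))) with (square_weight_S nu a (S p)).
  rewrite square_weight_S_rec.
  change (square_weight nu a (S p)) with (square_weight_S nu a p) in IH.
  pose proof (pos_INR p). pose proof (INR_fact_lt_0 (S p)) as hf.
  pose proof (product_weight_bound nu p h) as hB.
  assert (hB2 : product_weight nu p <= K / INR (fact (S p))).
  { eapply Rle_trans; [apply Rle_abs|]. eapply Rle_trans; [exact hB|].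
    apply Rmult_le_compat_r; [apply Rlt_le, Rinv_0_lt_compat, hf|unfold K; lra]. }
  pose proof (square_weight_nonneg nu a (S p) hg) as hD.
  change (square_weight nu a (S p)) with (square_weight_S nu a p) in hD.
  assert (hr : (2 * nu + INR p + 1 - a) / ((nu + INR p + 1) * (nu + INR p + 2)) <= 2).
  { apply Rle_div_l; [apply Rmult_lt_0_compat; lra|]. nra. }
  assert (h3p : 1 <= 3 ^ S p) by (apply pow_R1_Rle; lra).
  apply Rle_div_l; [lra|].
  apply Rle_trans with (K / INR (fact (S p)) + 2 * (K * (3 ^ S p / INR (fact (S p))))).
  + apply Rplus_le_compat; [exact hB2|].
    apply Rle_trans with (2 * square_weight_S nu a p); [now apply Rmult_le_compat_r|lra].
  + rewrite (fact_simpl (S p)), mult_INR, !S_INR.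
    change (3 ^ S (S p)) with (3 * 3 ^ S p).
    apply Rle_trans with (K * (3 * 3 ^ S p) / INR (fact (S p))).
    * replace (K / INR (fact (S p)) + 2 * (K * (3 ^ S p / INR (fact (S p)))))
        with (K * (1 + 2 * 3 ^ S p) / INR (fact (S p))) by (field; lra).
      apply Rmult_le_compat_r; [apply Rlt_le, Rinv_0_lt_compat, hf|].
      apply Rmult_le_compat_l; lra.
    * replace (K * (3 * 3 ^ S p / ((INR p + 1 + 1) * INR (fact (S p)))) * (a + INR p + 2))
        with (K * (3 * 3 ^ S p) / INR (fact (S p)) * ((a + INR p + 2) / (INR p + 2))) by (field;
          lra).
      rewrite <- (Rmult_1_r (K * _ / _)) at 1. apply Rmult_le_compat_l.
      -- apply Rdiv_le_0_compat; [|lra]. apply Rmult_le_pos; lra.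
      -- apply Rle_div_r; lra.
Qed.

(** Truncation changes the [k]-th coefficient by a part of
    [sum_n D_n |s_(n,k)|], which is a binomial sum of
    [(3 ^ n / n!) (8 ^ (k-n) / (k-n)!)], whence the constant 11. *)
Lemma square_sum_coef_error nu a : positivity_region nu a ->
  exists K, 0 <= K /\ forall N k, (N <= k)%nat ->
  Rabs (sum_f_R0 (fun n => square_weight nu a n * shifted_square_coef nu n k) N - sum_f_R0 (fun n
    => square_weight nu a n * shifted_square_coef nu n k) k)
  <= K * (11 ^ k / INR (fact k)).
Proof.
intros hg. destruct (square_weight_bound nu a hg) as (K & hK & HK). exists K. split; [exact hK|].
intros N k hN. set (f := fun n => square_weight nu a n * shifted_square_coef nu n k).
assert (H : forall q, Rabs (sum_f_R0 f N - sum_f_R0 f (N + q))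
   <= sum_f_R0 (fun n => Rabs (f n)) (N + q) - sum_f_R0 (fun n => Rabs (f n)) N).
{ induction q as [|q IH].
  - rewrite Nat.add_0_r, !Rminus_diag, Rabs_R0. lra.
  - rewrite Nat.add_succ_r, !tech5.
    replace (sum_f_R0 f N - (sum_f_R0 f (N + q) + f (S (N + q))))
      with ((sum_f_R0 f N - sum_f_R0 f (N + q)) + - f (S (N + q))) by ring.
    eapply Rle_trans; [apply Rabs_triang|]. rewrite Rabs_Ropp. lra. }
specialize (H (k - N)%nat). replace (N + (k - N))%nat with k in H by lia.
eapply Rle_trans; [exact H|].
assert (H0 : 0 <= sum_f_R0 (fun n => Rabs (f n)) N) by (apply cond_pos_sum; intros; apply Rabs_pos).
apply Rle_trans with (sum_f_R0 (fun n => Rabs (f n)) k); [lra|].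
apply Rle_trans with (sum_f_R0 (fun n => Binomial.C k n * 3 ^ n * 8 ^ (k - n)
  * (K / INR (fact k))) k).
- apply sum_Rle. intros n hn. unfold f. rewrite Rabs_mult, (Rabs_pos_eq (square_weight nu a n))
    by now apply square_weight_nonneg.
  replace k with (n + (k - n))%nat at 1 by lia. rewrite shifted_square_coef_diag by apply hg.
  replace (Binomial.C k n * 3 ^ n * 8 ^ (k - n) * (K / INR (fact k)))
    with (K * (3 ^ n / INR (fact n)) * (8 ^ (k - n) / INR (fact (k - n)))).
  2:{ unfold Binomial.C. field. repeat split; apply INR_fact_neq_0. }
  apply Rmult_le_compat; [now apply square_weight_nonneg|apply Rabs_pos|apply HK|].
  apply square_coef_bound. destruct hg. pose proof (pos_INR n). lra.
- rewrite <- scal_sum, <- binomial. right. replace (3 + 8) with 11 by ring. unfold Rdiv. ring.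
Qed.

(** The partial sum of index [N] agrees with [phi] up to the coefficient of
    [t ^ N], and the later coefficients have a summable bound
    uniform in [N].  This replaces an interchange of two infinite sums. *)
Lemma square_sum_lim nu a t : positivity_region nu a ->
  is_lim_seq (fun N => square_sum nu a N t) (phi (2 * nu + 1 / 2) a (4 * t)).
Proof.
intros hg. pose proof hg as (h & ha & h3 & h4).
destruct (square_sum_coef_error nu a hg) as (K & hK & HK).
set (M := fun k => K * ((11 * Rabs t) ^ k / INR (fact k))).
assert (hM : ex_series M) by apply ex_series_exp.
assert (Hphi : is_pseries (fun k => sum_f_R0 (fun n => square_weight nu a n
  * shifted_square_coef nu n k) k) t
   (phi (2 * nu + 1 / 2) a (4 * t))).
{ unfold phi. assert (hp : is_pseries (phi_coef (2 * nu + 1 / 2) a) (4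
    * t) (PSeries (phi_coef (2 * nu + 1 / 2) a) (4 * t))).
  { apply PSeries_correct, decay_ex_pseries, phi_coef_decay; lra. }
  unfold is_pseries in *. eapply is_series_ext; [|exact hp].
  intros k. cbv beta. rewrite phi_coef_squares by assumption.
  etransitivity; [apply pseries_term|]. symmetry. etransitivity; [apply pseries_term|].
  rewrite Rpow_mult_distr. unfold phi_coef.
  match goal with |- ?u = ?v => change (@eq R u v) end. ring. }
assert (Hb : forall N, Rabs (square_sum nu a N t - phi (2 * nu + 1 / 2) a (4 * t))
   <= Series M - sum_f_R0 M N).
{ intros N. set (d := fun k => (sum_f_R0 (fun n => square_weight nu a n
    * shifted_square_coef nu n k) N - sum_f_R0 (fun n => square_weight nu a n
        * shifted_square_coef nu n k) k) * t ^ k).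
  assert (Hd : is_series d (square_sum nu a N t - phi (2 * nu + 1 / 2) a (4 * t))).
  { pose proof (is_series_minus _ _ _ _ (square_sum_series nu a N t h) Hphi) as Hm.
    eapply is_series_ext; [|exact Hm]. intros k. unfold d.
    rewrite !pow_n_pow. unfold minus, plus, opp, scal; simpl; unfold mult; simpl. ring. }
  assert (Hd0 : forall k, (k <= N)%nat -> d k = 0).
  { intros k hk. unfold d.
    assert (Hs : forall q, sum_f_R0 (fun n => square_weight nu a n
      * shifted_square_coef nu n k) (k + q)
          = sum_f_R0 (fun n => square_weight nu a n * shifted_square_coef nu n k) k).
    { induction q as [|q IH]; [now rewrite Nat.add_0_r|].
      rewrite Nat.add_succ_r, tech5, IH. replace (S (k + q)) with (S k + q)%nat by lia.
      rewrite shifted_square_coef_zero. ring. }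
    replace N with (k + (N - k))%nat by lia. rewrite Hs. ring. }
  assert (HdM : forall k, (N <= k)%nat -> Rabs (d k) <= M k).
  { intros k hk. unfold d, M. rewrite Rabs_mult, <- RPow_abs, Rpow_mult_distr.
    replace (K * (11 ^ k * Rabs t ^ k / INR (fact k)))
      with (K * (11 ^ k / INR (fact k)) * Rabs t ^ k).
    - apply Rmult_le_compat_r; [apply pow_le, Rabs_pos|now apply HK].
    - field. apply INR_fact_neq_0. }
  rewrite <- (is_series_unique _ _ Hd).
  rewrite (Series_incr_n d (S N)) by (lia || (eexists; exact Hd)). simpl pred.
  rewrite (sum_eq _ (fun _ => 0)) by (intros; now apply Hd0).
  rewrite sum_cte, Rmult_0_l, Rplus_0_l.
  assert (hMN : ex_series (fun k => M (S N + k)%nat)) by now apply ex_series_incr_n.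
  assert (hdN : ex_series (fun k => Rabs (d (S N + k)%nat))).
  { apply (ex_series_le (fun k => Rabs (d (S N + k)%nat)) (fun k => M (S N + k)%nat)); [|exact hMN].
    intros k. unfold norm; simpl; unfold abs; simpl. rewrite Rabs_Rabsolu.
    apply (HdM (S N + k)%nat). lia. }
  eapply Rle_trans; [apply Series_Rabs, hdN|].
  apply Rle_trans with (Series (fun k => M (S N + k)%nat)).
  - apply Series_le; [|exact hMN]. intros k. split; [apply Rabs_pos|apply HdM; lia].
  - rewrite (Series_incr_n M (S N)) by (lia || exact hM). simpl pred. lra. }
assert (HM0 : is_lim_seq (fun N => Series M - sum_f_R0 M N) 0).
{ replace (Finite 0) with (Finite (Series M - Series M)) by (f_equal; ring).
  apply is_lim_seq_minus'; [apply is_lim_seq_const|].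
  pose proof (Series_correct M hM) as Hs.
  eapply is_lim_seq_ext; [|exact Hs]. intros n. apply sum_n_Reals. }
apply is_lim_seq_le_le with
  (fun N => phi (2 * nu + 1 / 2) a (4 * t) - (Series M - sum_f_R0 M N))
  (fun N => phi (2 * nu + 1 / 2) a (4 * t) + (Series M - sum_f_R0 M N)).
- intros N. specialize (Hb N). apply Rabs_le_between in Hb. lra.
- replace (Finite (phi (2 * nu + 1 / 2) a (4 * t)))
    with (Finite (phi (2 * nu + 1 / 2) a (4 * t) - 0)) by (f_equal; ring).
  apply is_lim_seq_minus'; [apply is_lim_seq_const|exact HM0].
- replace (Finite (phi (2 * nu + 1 / 2) a (4 * t)))
    with (Finite (phi (2 * nu + 1 / 2) a (4 * t) + 0)) by (f_equal; ring).
  apply is_lim_seq_plus'; [apply is_lim_seq_const|exact HM0].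
Qed.

Lemma phi_ge_square_sum nu a t N : positivity_region nu a -> 0 <= t ->
  square_sum nu a N t <= phi (2 * nu + 1 / 2) a (4 * t).
Proof.
intros hg ht.
refine (is_lim_seq_incr_compare (fun N => square_sum nu a N t) _ (square_sum_lim nu a t hg) _ N).
intros n. unfold square_sum. rewrite tech5.
assert (0 <= square_weight nu a (S n) * (t ^ S n * hyp01 (nu + INR (S n) + 1) t ^ 2)); [|lra].
apply Rmult_le_pos; [now apply square_weight_nonneg|]. apply Rmult_le_pos;
  [now apply pow_le|apply pow2_ge_0].
Qed.

Lemma phi_ge_square nu a t n : positivity_region nu a -> 0 <= t ->
  square_weight nu a n * (t ^ n * hyp01 (nu + INR n + 1) t ^ 2) <= phi (2 * nu + 1 / 2) a (4 * t).
Proof.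
intros hg ht. eapply Rle_trans; [|now apply (phi_ge_square_sum nu a t n)].
unfold square_sum.
assert (hp : forall m, 0 <= square_weight nu a m * (t ^ m * hyp01 (nu + INR m + 1) t ^ 2)).
{ intros m. apply Rmult_le_pos; [now apply square_weight_nonneg|].
  apply Rmult_le_pos; [now apply pow_le|apply pow2_ge_0]. }
destruct n as [|n]; [apply Rle_refl|]. rewrite tech5.
pose proof (cond_pos_sum _ n hp). lra.
Qed.

(** The part of the series beyond its constant term 1 is at most
    [(exp |t| - 1) / c]. *)
Lemma hyp01_large t : exists C, forall c, 1 <= c -> C < c -> 0 < hyp01 c t.
Proof.
pose proof (ex_series_exp 1 (Rabs t)) as hE.
set (M := fun k => 1 * (Rabs t ^ k / INR (fact k))) in hE.
exists (Series (fun k => M (S k))). intros c hc hC.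
assert (hM : ex_series (fun k => M (S k))) by now apply (ex_series_incr_1 M).
assert (hj : forall k, Rabs (hyp01_coef c (S k)) <= / c * / INR (fact (S k))).
{ induction k as [|k IH].
  - simpl. rewrite Rmult_1_r, Rabs_Ropp, Rabs_pos_eq.
    + right. field. lra.
    + apply Rlt_le, Rinv_0_lt_compat. lra.
  - pose proof (pos_INR k).
    change (hyp01_coef c (S (S k))) with (- / ((c + INR (S k)) * (INR (S k) + 1))
      * hyp01_coef c (S k)).
    rewrite (fact_simpl (S k)), mult_INR, Rabs_mult, Rabs_Ropp, Rabs_pos_eq, !S_INR.
    2:{ rewrite S_INR. apply Rlt_le, Rinv_0_lt_compat. nra. }
    replace (/ c * / ((INR k + 1 + 1) * INR (fact (S k))))
      with (/ (INR k + 1 + 1) * (/ c * / INR (fact (S k)))).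
    2:{ field. repeat split; try lra. apply INR_fact_neq_0. }
    apply Rmult_le_compat; auto using Rabs_pos.
    + apply Rlt_le, Rinv_0_lt_compat. nra.
    + apply Rinv_le_contravar; nra. }
assert (hs : ex_series (fun k => hyp01_coef c k * t ^ k)).
{ apply ex_series_Rabs, decay_ex_series_abs, hyp01_coef_decay. lra. }
unfold hyp01, PSeries. rewrite Series_incr_1 by exact hs.
assert (hb : forall k, Rabs (hyp01_coef c (S k) * t ^ S k) <= / c * M (S k)).
{ intros k. rewrite Rabs_mult, <- RPow_abs. unfold M.
  replace (/ c * (1 * (Rabs t ^ S k / INR (fact (S k)))))
    with (/ c * / INR (fact (S k)) * Rabs t ^ S k) by (unfold Rdiv; ring).
  apply Rmult_le_compat_r; [apply pow_le, Rabs_pos|apply hj]. }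
assert (hcM : ex_series (fun k => / c * M (S k))) by now apply (ex_series_scal_l (/ c) (fun k =>
  M (S k))).
assert (hr : Rabs (Series (fun k => hyp01_coef c (S k) * t ^ S k))
  <= / c * Series (fun k => M (S k))).
{ rewrite <- Series_scal_l. eapply Rle_trans; [apply Series_Rabs|].
  - apply (ex_series_le (fun k => Rabs (hyp01_coef c (S k) * t ^ S k)) (fun k => / c * M (S k)));
      [|exact hcM].
    intros k. unfold norm; simpl norm; unfold abs; simpl abs. rewrite Rabs_Rabsolu. apply hb.
  - apply Series_le; [|exact hcM]. intros k. split; [apply Rabs_pos|apply hb]. }
apply Rabs_le_between in hr. simpl (hyp01_coef c 0 * t ^ 0).
assert (/ c * Series (fun k => M (S k)) < 1).
{ apply Rmult_lt_reg_l with c; [lra|]. rewrite <- Rmult_assoc, Rinv_r by lra. lra. }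
lra.
Qed.

Lemma phi_nonneg nu a t : positivity_region nu a -> 0 <= t -> 0 <= phi (2 * nu + 1 / 2) a (4 * t).
Proof.
intros hg ht. eapply Rle_trans; [|apply (phi_ge_square nu a t 0 hg ht)].
apply Rmult_le_pos; [now apply square_weight_nonneg|]. apply Rmult_le_pos;
  [now apply pow_le|apply pow2_ge_0].
Qed.

Lemma phi_pos nu a t : positivity_region nu a -> ~ (nu = 1 / 2 /\ a = 1) -> 0 < t ->
  0 < phi (2 * nu + 1 / 2) a (4 * t).
Proof.
intros hg hne ht. destruct (hyp01_large t) as (C & HC).
destruct (INR_unbounded (Rabs C)) as (p & hp).
eapply Rlt_le_trans; [|apply (phi_ge_square nu a t (S (S p)) hg); lra].
apply Rmult_lt_0_compat; [now apply square_weight_pos|].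
apply Rmult_lt_0_compat; [now apply pow_lt|]. apply pow_lt.
destruct hg as (h & _). pose proof (pos_INR p). pose proof (Rle_abs C).
apply HC; rewrite !S_INR; lra.
Qed.

(** * Differential equations of the two series *)

Lemma nondecreasing_of_derive (f df : R -> R) (a b : R) : a <= b ->
  (forall x, a <= x <= b -> is_derive f x (df x)) ->
  (forall x, a <= x <= b -> 0 <= df x) -> f a <= f b.
Proof.
intros hab hd hp. destruct (Req_dec a b) as [->|hne]; [lra|].
destruct (MVT_cor2 f df a b) as (c & hc & hc2); [lra| |].
- intros c hc. apply is_derive_Reals, hd, hc.
- assert (0 <= df c) by (apply hp; lra). nra.
Qed.

Definition dhyp01 (c t : R) : R := PSeries (PS_derive (hyp01_coef c)) t.
Definition ddhyp01 (c t : R) : R := PSeries (PS_derive (PS_derive (hyp01_coef c))) t.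

Lemma hyp01_derive c t : 0 < c -> is_derive (hyp01 c) t (dhyp01 c t).
Proof. intros hc. apply is_derive_PSeries, decay_radius, hyp01_coef_decay, hc. Qed.

Lemma dhyp01_derive c t : 0 < c -> is_derive (dhyp01 c) t (ddhyp01 c t).
Proof.
intros hc. apply is_derive_PSeries. rewrite CV_radius_derive.
apply decay_radius, hyp01_coef_decay, hc.
Qed.

Lemma PS_plusE (p q : nat -> R) k : PS_plus p q k = p k + q k.
Proof. reflexivity. Qed.

Lemma PS_scalE (x : R) (p : nat -> R) k : PS_scal x p k = x * p k.
Proof. reflexivity. Qed.

Lemma PS_euler_coef (p : nat -> R) k : PS_incr_1 (PS_derive p) k = INR k * p k.
Proof. destruct k as [|k]; simpl; [rewrite Rmult_0_l; reflexivity|reflexivity]. Qed.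

Lemma hyp01_ode c t : 0 < c -> t * ddhyp01 c t + c * dhyp01 c t + hyp01 c t = 0.
Proof.
intros hc. unfold ddhyp01, dhyp01, hyp01.
assert (h0 : ex_pseries (hyp01_coef c) t) by (apply decay_ex_pseries, hyp01_coef_decay, hc).
assert (h1 : ex_pseries (PS_derive (hyp01_coef c)) t).
{ apply CV_radius_inside. rewrite CV_radius_derive. apply decay_radius, hyp01_coef_decay, hc. }
assert (h2 : ex_pseries (PS_derive (PS_derive (hyp01_coef c))) t).
{ apply CV_radius_inside. rewrite !CV_radius_derive. apply decay_radius, hyp01_coef_decay, hc. }
rewrite <- PSeries_incr_1, <- (PSeries_scal c).
rewrite <- !PSeries_plus; auto using ex_pseries_incr_1.
- rewrite (PSeries_ext _ (fun _ => 0)); [apply PSeries_const_0|].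
  intros k. rewrite !PS_plusE, PS_scalE, PS_euler_coef. unfold PS_derive. cbn [hyp01_coef].
  rewrite S_INR. pose proof (pos_INR k). field. lra.
- apply ex_pseries_plus; [now apply ex_pseries_incr_1|].
  apply ex_pseries_scal; [apply Rmult_comm|exact h1].
- apply ex_pseries_scal; [apply Rmult_comm|exact h1].
Qed.

Definition dphi (c a t : R) : R := PSeries (PS_derive (phi_coef c a)) t.

Lemma phi_derive c a t : 0 < c -> 0 < a -> is_derive (phi c a) t (dphi c a t).
Proof. intros hc ha. now apply is_derive_PSeries, decay_radius, phi_coef_decay. Qed.

Lemma phi_euler c a t : 0 < c -> 0 < a -> a * phi c a t + t * dphi c a t = hyp01 c t.
Proof.
intros hc ha. unfold phi, dphi, hyp01.
assert (h0 : ex_pseries (phi_coef c a) t) by now apply decay_ex_pseries, phi_coef_decay.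
assert (h1 : ex_pseries (PS_derive (phi_coef c a)) t).
{ apply CV_radius_inside. rewrite CV_radius_derive. now apply decay_radius, phi_coef_decay. }
rewrite <- PSeries_incr_1, <- PSeries_scal.
rewrite <- PSeries_plus; [|apply ex_pseries_scal; [apply Rmult_comm|exact h0]|now apply
  ex_pseries_incr_1].
apply PSeries_ext. intros k. rewrite PS_plusE, PS_scalE, PS_euler_coef.
unfold phi_coef. pose proof (pos_INR k). field. lra.
Qed.

Lemma Rpower_derive s x : 0 < x -> is_derive (fun y => Rpower y s) x (s * Rpower x (s - 1)).
Proof. intros hx. apply is_derive_Reals. now apply derivable_pt_lim_power. Qed.

Lemma Rpower_add1 x s : 0 < x -> Rpower x (s - 1) * x = Rpower x s.
Proof.
intros hx. rewrite <- (Rpower_1 x) at 2 by assumption. rewrite <- Rpower_plus. f_equal. ring.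
Qed.

Lemma Rpower_lim_0 s : 0 < s -> filterlim (fun x => Rpower x s) (at_right 0) (locally 0).
Proof.
intros hs. apply filterlim_locally. intros eps.
assert (hd : 0 < Rpower eps (/ s)) by apply exp_pos.
exists (mkposreal _ hd). intros x hx hx0. unfold ball in *; simpl in *; unfold AbsRing_ball in *;
  simpl in *.
unfold abs, minus, plus, opp in *; simpl in *.
rewrite Ropp_0, Rplus_0_r in *. rewrite Rabs_pos_eq in * by (apply Rlt_le; try apply exp_pos; lra).
replace (pos eps) with (Rpower (Rpower eps (/ s)) s).
- apply Rlt_Rpower_l; [exact hs|split; lra].
- rewrite Rpower_mult, Rinv_l, Rpower_1; [reflexivity|apply cond_pos|lra].
Qed.

(** The function [w ^ a' (phi c a' w - phi c a w)] vanishes at 0 and has the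
    derivative [(a - a') w ^ (a' - 1) phi c a w]. *)
Lemma phi_monotone c a a' t : 0 < c -> 0 < a' -> a' <= a ->
  (forall w, 0 < w -> 0 <= phi c a w) -> 0 < t -> phi c a t <= phi c a' t.
Proof.
intros hc ha' haa hpos ht. assert (ha : 0 < a) by lra.
set (H := fun w => Rpower w a' * (phi c a' w - phi c a w)).
assert (Hd : forall w, 0 < w -> is_derive H w (Rpower w (a' - 1) * ((a - a') * phi c a w))).
{ intros w hw. unfold H.
  replace (Rpower w (a' - 1) * ((a - a') * phi c a w))
    with (a' * Rpower w (a' - 1) * (phi c a' w - phi c a w) + Rpower w a'
      * (dphi c a' w - dphi c a w)).
  - apply (is_derive_mult (fun w => Rpower w a') (fun w => phi c a' w - phi c a w)).
    + now apply Rpower_derive.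
    + apply (is_derive_minus (phi c a') (phi c a)); now apply phi_derive.
    + apply Rmult_comm.
  - rewrite <- (Rpower_add1 w a') by assumption.
    pose proof (phi_euler c a w hc ha). pose proof (phi_euler c a' w hc ha').
    replace (Rpower w (a' - 1) * w * (dphi c a' w - dphi c a w))
      with (Rpower w (a' - 1) * (w * dphi c a' w - w * dphi c a w)) by ring.
    replace (w * dphi c a' w) with (hyp01 c w - a' * phi c a' w) by lra.
    replace (w * dphi c a w) with (hyp01 c w - a * phi c a w) by lra. ring. }
assert (Hinc : forall e, 0 < e <= t -> H e <= H t).
{ intros e he. apply nondecreasing_of_derive
    with (fun w => Rpower w (a' - 1) * ((a - a') * phi c a w)); [lra| |].
  - intros x hx. apply Hd. lra.
  - intros x hx. apply Rmult_le_pos; [apply Rlt_le, exp_pos|].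
    apply Rmult_le_pos; [lra|apply hpos; lra]. }
assert (Hlim : filterlim H (at_right 0) (locally 0)).
{ replace 0 with (0 * (phi c a' 0 - phi c a 0)) at 2 by ring. unfold H.
  eapply (filterlim_comp_2 _ _ Rmult).
  - now apply Rpower_lim_0.
  - eapply filterlim_filter_le_1; [apply filter_le_within|].
    apply (ex_derive_continuous (fun w => phi c a' w - phi c a w) 0).
    eexists. apply (is_derive_minus (phi c a') (phi c a)); now apply phi_derive.
  - apply (filterlim_mult (K := R_AbsRing) 0 (phi c a' 0 - phi c a 0)). }
assert (H0 : 0 <= H t).
{ apply (filterlim_le (F := at_right 0) H (fun _ => H t) 0 (H t)).
  - exists (mkposreal t ht). intros y hy hy0. apply Hinc. split; [exact hy0|].
    unfold ball in hy; simpl in hy; unfold AbsRing_ball, abs, minus, plus, opp in hy; simpl in hy.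
    apply Rabs_lt_between in hy. lra.
  - exact Hlim.
  - apply filterlim_const. }
unfold H in H0. pose proof (exp_pos (a' * ln t)) as he. fold (Rpower t a') in he. nra.
Qed.

(** * Oscillation of perturbed harmonic motion *)

Definition normal_form (kappa : R) (u u1 : R -> R) : Prop :=
  forall x, 0 < x -> is_derive u x (u1 x) /\ is_derive u1 x ((kappa / x ^ 2 - 1) * u x).

Definition energy (u u1 : R -> R) (x : R) : R := u x ^ 2 + u1 x ^ 2.

Lemma energy_derive kappa u u1 x : normal_form kappa u u1 -> 0 < x ->
  is_derive (energy u u1) x (2 * kappa / x ^ 2 * (u x * u1 x)).
Proof.
intros hn hx. unfold energy. destruct (hn x hx) as [hu hu1].
auto_derive.
- repeat split; eexists; eassumption.
- assert (e : Derive (fun y : R => u y) x = u1 x) by now apply is_derive_unique.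
  assert (e1 : Derive (fun y : R => u1 y) x = (kappa / x ^ 2 - 1) * u x)
    by now apply is_derive_unique.
  rewrite e, e1. field. lra.
Qed.

Lemma energy_derive_bound kappa (u u1 : R -> R) x : 0 < x ->
  Rabs (2 * kappa / x ^ 2 * (u x * u1 x)) <= Rabs kappa / x ^ 2 * energy u u1 x.
Proof.
intros hx. assert (h2 : 0 < x ^ 2) by now apply pow_lt.
replace (2 * kappa / x ^ 2 * (u x * u1 x)) with (kappa * / x ^ 2 * (2 * u x * u1 x))
  by (unfold Rdiv; ring).
rewrite !Rabs_mult. rewrite (Rabs_pos_eq (/ x ^ 2)) by (apply Rlt_le, Rinv_0_lt_compat, h2).
apply Rmult_le_compat_l.
- apply Rmult_le_pos; [apply Rabs_pos|apply Rlt_le, Rinv_0_lt_compat, h2].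
- rewrite <- !Rabs_mult. apply Rabs_le. unfold energy.
  pose proof (pow2_ge_0 (u x - u1 x)). pose proof (pow2_ge_0 (u x + u1 x)). split; nra.
Qed.

Lemma exp_div_derive c x : 0 < x -> is_derive (fun y => exp (c / y)) x (- c / x ^ 2 * exp (c / x)).
Proof. intros hx. auto_derive; [lra|]. unfold Rdiv. field. lra. Qed.

(** Gronwall's argument: the logarithmic derivative of the energy is at most
    [|kappa| / x ^ 2], which is integrable at infinity. *)
Lemma energy_bounds kappa u u1 x0 x : normal_form kappa u u1 -> 0 < x0 -> x0 <= x ->
  energy u u1 x0 * exp (- Rabs kappa / x0) <= energy u u1 x
    <= energy u u1 x0 * exp (Rabs kappa / x0).
Proof.
intros hn hx0 hx. assert (hk : 0 <= Rabs kappa) by apply Rabs_pos.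
assert (hE : forall y, 0 <= energy u u1 y) by (intros y; unfold energy; nra).
assert (hkx : forall y, 0 < y -> 0 <= Rabs kappa / y) by (intros y hy; now apply Rdiv_le_0_compat).
split.
- apply Rle_trans with (energy u u1 x * exp (- Rabs kappa / x)).
  + apply (nondecreasing_of_derive (fun y => energy u u1 y * exp (- Rabs kappa / y))
      (fun y => 2 * kappa / y ^ 2 * (u y * u1 y) * exp (- Rabs kappa / y) + energy u u1 y
        * (- - Rabs kappa / y ^ 2 * exp (- Rabs kappa / y)))); [exact hx| |].
    * intros y hy. apply (is_derive_mult (energy u u1) (fun y => exp (- Rabs kappa / y)));
        [apply energy_derive; [exact hn|lra]| |apply Rmult_comm].
      apply exp_div_derive. lra.
    * intros y hy. pose proof (energy_derive_bound kappa u u1 y ltac:(lra)) as hb.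
      apply Rabs_le_between in hb.
      pose proof (exp_pos (- Rabs kappa / y)). rewrite Ropp_involutive. nra.
  + rewrite <- (Rmult_1_r (energy u u1 x)) at 2. apply Rmult_le_compat_l; [apply hE|].
    rewrite <- exp_0.
    destruct (Req_dec (- Rabs kappa / x) 0) as [->|hne]; [lra|]. left. apply exp_increasing.
    specialize (hkx x ltac:(lra)). unfold Rdiv in *. lra.
- apply Rle_trans with (energy u u1 x * exp (Rabs kappa / x)).
  + rewrite <- (Rmult_1_r (energy u u1 x)) at 1. apply Rmult_le_compat_l; [apply hE|].
    specialize (hkx x ltac:(lra)). pose proof (exp_ineq1_le (Rabs kappa / x)). lra.
  + apply Ropp_le_cancel.
    apply (nondecreasing_of_derive (fun y => - (energy u u1 y * exp (Rabs kappa / y)))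
      (fun y => - (2 * kappa / y ^ 2 * (u y * u1 y) * exp (Rabs kappa / y) + energy u u1 y
        * (- Rabs kappa / y ^ 2 * exp (Rabs kappa / y))))); [exact hx| |].
    * intros y hy. apply (is_derive_opp (fun y => energy u u1 y * exp (Rabs kappa / y))).
      apply (is_derive_mult (energy u u1) (fun y => exp (Rabs kappa / y))); [apply energy_derive;
        [exact hn|lra]| |apply Rmult_comm].
      apply exp_div_derive. lra.
    * intros y hy. pose proof (energy_derive_bound kappa u u1 y ltac:(lra)) as hb.
      apply Rabs_le_between in hb.
      pose proof (exp_pos (Rabs kappa / y)). unfold Rdiv in *. nra.
Qed.

Lemma normal_form_bounded kappa u u1 x0 : normal_form kappa u u1 -> 0 < x0 ->
  exists U, 0 <= U /\ forall x, x0 <= x -> Rabs (u x) <= U.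
Proof.
intros hn hx0. exists (energy u u1 x0 * exp (Rabs kappa / x0) + 1).
assert (h : forall x, x0 <= x -> Rabs (u x) <= energy u u1 x0 * exp (Rabs kappa / x0) + 1).
{ intros x hx. destruct (energy_bounds kappa u u1 x0 x hn hx0 hx) as [_ h]. unfold energy in h at 1.
  apply Rabs_le. nra. }
split; [|exact h]. eapply Rle_trans; [apply Rabs_pos|apply (h x0); lra].
Qed.

(** In the frame rotating with the unperturbed motion, the point [(u, u1)] has
    coordinates [(A, B)] that vary by [O(1 / x ^ 2)] over one period, while their
    distance to the origin stays above a positive bound.  So within a late
    period the values of [u] and of [u1] at four quarter turns are close to
    [A, B, -A, -B] in some order. *)
Lemma normal_form_oscillates kappa u u1 x0 : normal_form kappa u u1 -> 0 < x0 -> u x0 <> 0 ->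
  exists m, 0 < m /\ forall X,
  (exists x, X <= x /\ x0 <= x /\ m <= u1 x) /\ (exists x, X <= x /\ x0 <= x /\ u x <= - m).
Proof.
intros hn hx0 hnz.
destruct (normal_form_bounded kappa u u1 x0 hn hx0) as (U & hU & HU).
set (M := sqrt (energy u u1 x0 * exp (- Rabs kappa / x0))).
assert (hE0 : 0 < energy u u1 x0 * exp (- Rabs kappa / x0)).
{ apply Rmult_lt_0_compat; [|apply exp_pos]. unfold energy.
  assert (0 < u x0 ^ 2) by (apply pow2_gt_0, hnz). nra. }
assert (hM : 0 < M) by now apply sqrt_lt_R0.
assert (hM2 : M * M = energy u u1 x0 * exp (- Rabs kappa / x0)) by (apply sqrt_sqrt; lra).
exists (M / 4). split; [lra|]. intros X.
assert (hk : 0 <= Rabs kappa) by apply Rabs_pos.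
set (A := fun x => u x * cos x - u1 x * sin x).
set (B := fun x => u x * sin x + u1 x * cos x).
assert (dA : forall x, 0 < x -> is_derive A x (- (kappa / x ^ 2 * u x) * sin x)).
{ intros x hx. unfold A. destruct (hn x hx) as [hu hu1]. auto_derive.
  - repeat split; eexists; eassumption.
  - assert (e : Derive (fun y : R => u y) x = u1 x) by now apply is_derive_unique.
  assert (e1 : Derive (fun y : R => u1 y) x = (kappa / x ^ 2 - 1) * u x)
    by now apply is_derive_unique.
  rewrite e, e1. field. lra. }
assert (dB : forall x, 0 < x -> is_derive B x (kappa / x ^ 2 * u x * cos x)).
{ intros x hx. unfold B. destruct (hn x hx) as [hu hu1]. auto_derive.
  - repeat split; eexists; eassumption.
  - assert (e : Derive (fun y : R => u y) x = u1 x) by now apply is_derive_unique.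
  assert (e1 : Derive (fun y : R => u1 y) x = (kappa / x ^ 2 - 1) * u x)
    by now apply is_derive_unique.
  rewrite e, e1. field. lra. }
assert (hAB : forall x, A x ^ 2 + B x ^ 2 = energy u u1 x).
{ intros x. unfold A, B, energy. pose proof (sin2_cos2 x) as hsc. unfold Rsqr in hsc.
  transitivity ((u x ^ 2 + u1 x ^ 2) * (sin x * sin x + cos x * cos x)); [ring|rewrite hsc; ring]. }
pose proof PI_RGT_0 as hpi. pose proof PI_4 as hpi4.
destruct (INR_unbounded (Rabs X + x0 + 1 + 32 * Rabs kappa * U / M)) as (n & hN).
(* [t] is a multiple of the period, far enough for the drift of [A] and [B] over
   [[t, t + 2 PI]] to be at most [M / 4]. *)
set (t := 2 * INR n * PI).
assert (hq : 0 <= 32 * Rabs kappa * U / M) by (apply Rdiv_le_0_compat; [|exact hM]; nra).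
assert (hPI2 : 2 <= PI) by (pose proof PI2_1; lra).
assert (ht : INR n <= t) by (unfold t; pose proof (pos_INR n); nra).
pose proof (Rle_abs X) as hX. pose proof (Rabs_pos X) as hX0.
assert (vary : forall (f df : R -> R), (forall x, 0 < x -> is_derive f x (df x)) ->
   (forall x, x0 <= x -> Rabs (df x) <= Rabs kappa * U / x ^ 2) ->
   forall s, 0 <= s <= 2 * PI -> Rabs (f (t + s) - f t) <= M / 4).
{ intros f df hf hdf s hs.
  destruct (MVT_abs f df t (t + s)) as (c & hc & hc2).
  { intros c hc. apply is_derive_Reals, hf. rewrite Rmin_left in hc by lra. lra. }
  rewrite Rmin_left, Rmax_right in hc2 by lra. rewrite hc.
  replace (t + s - t) with s by ring. rewrite (Rabs_pos_eq s) by lra.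
  apply Rle_trans with (Rabs kappa * U / c ^ 2 * 8).
  - apply Rmult_le_compat; [apply Rabs_pos|lra| |lra]. apply hdf. lra.
  - assert (hc1 : 1 <= c) by lra.
    assert (hcM : 32 * Rabs kappa * U / M <= c) by lra.
    apply (Rle_div_l (32 * Rabs kappa * U)) in hcM; [|exact hM].
    replace (Rabs kappa * U / c ^ 2 * 8) with (32 * Rabs kappa * U / (4 * c ^ 2)) by (field; lra).
    apply Rle_div_l; [nra|]. assert (c * M <= c * c * M) by (apply Rmult_le_compat_r; nra). lra. }
assert (hdA : forall x, x0 <= x -> Rabs (- (kappa / x ^ 2 * u x) * sin x)
  <= Rabs kappa * U / x ^ 2).
{ intros x hx. assert (h2 : 0 < x ^ 2) by (apply pow_lt; lra).
  replace (- (kappa / x ^ 2 * u x) * sin x) with (- (kappa * u x * / x ^ 2 * sin x)) by (field;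
    lra).
  rewrite Rabs_Ropp, !Rabs_mult, (Rabs_pos_eq (/ x ^ 2)) by (apply Rlt_le, Rinv_0_lt_compat, h2).
  rewrite <- (Rmult_1_r (Rabs kappa * U / x ^ 2)). unfold Rdiv.
  apply Rmult_le_compat; [|apply Rabs_pos| |apply Rabs_le, SIN_bound].
  - apply Rmult_le_pos; [apply Rmult_le_pos; [exact hk|apply Rabs_pos]|apply Rlt_le,
      Rinv_0_lt_compat, h2].
  - apply Rmult_le_compat_r; [apply Rlt_le, Rinv_0_lt_compat, h2|].
    apply Rmult_le_compat_l; [exact hk|now apply HU]. }
assert (hdB : forall x, x0 <= x -> Rabs (kappa / x ^ 2 * u x * cos x) <= Rabs kappa * U / x ^ 2).
{ intros x hx. assert (h2 : 0 < x ^ 2) by (apply pow_lt; lra).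
  replace (kappa / x ^ 2 * u x * cos x) with (kappa * u x * / x ^ 2 * cos x) by (field; lra).
  rewrite !Rabs_mult, (Rabs_pos_eq (/ x ^ 2)) by (apply Rlt_le, Rinv_0_lt_compat, h2).
  rewrite <- (Rmult_1_r (Rabs kappa * U / x ^ 2)). unfold Rdiv.
  apply Rmult_le_compat; [|apply Rabs_pos| |apply Rabs_le, COS_bound].
  - apply Rmult_le_pos; [apply Rmult_le_pos; [exact hk|apply Rabs_pos]|apply Rlt_le,
      Rinv_0_lt_compat, h2].
  - apply Rmult_le_compat_r; [apply Rlt_le, Rinv_0_lt_compat, h2|].
    apply Rmult_le_compat_l; [exact hk|now apply HU]. }
pose proof (vary A _ dA hdA) as vA. pose proof (vary B _ dB hdB) as vB.
assert (s0 : sin t = 0 /\ cos t = 1).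
{ unfold t. split.
  - replace (2 * INR n * PI) with (0 + 2 * INR n * PI) by ring. rewrite sin_period. apply sin_0.
  - replace (2 * INR n * PI) with (0 + 2 * INR n * PI) by ring. rewrite cos_period. apply cos_0. }
destruct s0 as [sn cs].
assert (p1 : u (t + 0) = A (t + 0) /\ u1 (t + 0) = B (t + 0)).
{ unfold A, B. rewrite Rplus_0_r, sn, cs. split; ring. }
assert (p2 : u (t + PI / 2) = B (t + PI / 2) /\ u1 (t + PI / 2) = - A (t + PI / 2)).
{ unfold A, B. rewrite sin_plus, cos_plus, sin_PI2, cos_PI2, sn, cs. split; ring. }
assert (p3 : u (t + PI) = - A (t + PI) /\ u1 (t + PI) = - B (t + PI)).
{ unfold A, B. rewrite neg_sin, neg_cos, sn, cs. split; ring. }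
assert (p4 : u (t + 3 * (PI / 2)) = - B (t + 3 * (PI / 2)) /\ u1 (t + 3 * (PI / 2))
  = A (t + 3 * (PI / 2))).
{ unfold A, B. rewrite sin_plus, cos_plus, sin_3PI2, cos_3PI2, sn, cs. split; ring. }
pose proof (vA 0 ltac:(lra)) as a1. pose proof (vB 0 ltac:(lra)) as b1.
pose proof (vA (PI / 2) ltac:(lra)) as a2. pose proof (vB (PI / 2) ltac:(lra)) as b2.
pose proof (vA PI ltac:(lra)) as a3. pose proof (vB PI ltac:(lra)) as b3.
pose proof (vA (3 * (PI / 2)) ltac:(lra)) as a4. pose proof (vB (3 * (PI / 2)) ltac:(lra)) as b4.
apply Rabs_le_between in a1, b1, a2, b2, a3, b3, a4, b4.
assert (hbig : M / 2 <= A t \/ A t <= - (M / 2) \/ M / 2 <= B t \/ B t <= - (M / 2)).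
{ destruct (Rle_or_lt (M / 2) (A t)) as [?|h1]; [now left|].
  destruct (Rle_or_lt (A t) (- (M / 2))) as [?|h2]; [now right; left|].
  destruct (Rle_or_lt (M / 2) (B t)) as [?|h3]; [now right; right; left|].
  destruct (Rle_or_lt (B t) (- (M / 2))) as [?|h4]; [now right; right; right|].
  exfalso. pose proof (hAB t) as h. destruct (energy_bounds kappa u u1 x0 t hn hx0 ltac:(lra)) as
    [hb _].
  assert (A t ^ 2 <= (M / 2) ^ 2) by nra. assert (B t ^ 2 <= (M / 2) ^ 2) by nra. nra. }
assert (x1 : X <= t) by lra. assert (x2 : x0 <= t) by lra.
destruct hbig as [h|[h|[h|h]]]; split.
- exists (t + 3 * (PI / 2)); lra.
- exists (t + PI); lra.
- exists (t + PI / 2); lra.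
- exists (t + 0); lra.
- exists (t + 0); lra.
- exists (t + 3 * (PI / 2)); lra.
- exists (t + PI); lra.
- exists (t + PI / 2); lra.
Qed.

(** * Necessary conditions *)

(** A multiple of [x ^ (1/2) J_(c-1) (x)]; the square root removes the
    first-order term from Bessel's equation. *)
Definition scaled_bessel (c x : R) : R := Rpower x (c - 1 / 2) * hyp01 c (x ^ 2 / 4).
Definition scaled_bessel_derivative (c x : R) : R :=
  (c - 1 / 2) * Rpower x (c - 1 / 2 - 1) * hyp01 c (x ^ 2 / 4)
  + Rpower x (c - 1 / 2) * (x / 2 * dhyp01 c (x ^ 2 / 4)).

Lemma quarter_square_derive (f : R -> R) (x l : R) :
  is_derive f (x ^ 2 / 4) l -> is_derive (fun y => f (y ^ 2 / 4)) x (x / 2 * l).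
Proof.
intros hf. apply (is_derive_comp f (fun y => y ^ 2 / 4)); [exact hf|].
auto_derive; [exact I|field].
Qed.

Lemma scaled_bessel_normal_form c : 0 < c -> normal_form ((c - 1) ^ 2 - 1 / 4) (scaled_bessel c)
  (scaled_bessel_derivative c).
Proof.
intros hc x hx. split.
- unfold scaled_bessel, scaled_bessel_derivative.
  apply (is_derive_mult (fun y => Rpower y (c - 1 / 2)) (fun y => hyp01 c (y ^ 2 / 4)) x
    ((c - 1 / 2) * Rpower x (c - 1 / 2 - 1)) (x / 2 * dhyp01 c (x ^ 2 / 4))).
  + now apply Rpower_derive.
  + now apply quarter_square_derive, hyp01_derive.
  + apply Rmult_comm.
- unfold scaled_bessel, scaled_bessel_derivative.
  set (p := c - 1 / 2). set (w := x ^ 2 / 4).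
  replace (((c - 1) ^ 2 - 1 / 4) / x ^ 2 - 1) with (p * (p - 1) / x ^ 2 - 1) by (unfold p; field;
    lra).
  evar_last.
  + apply (is_derive_plus (fun y => p * Rpower y (p - 1) * hyp01 c (y ^ 2 / 4))
      (fun y => Rpower y p * (y / 2 * dhyp01 c (y ^ 2 / 4)))).
    * apply (is_derive_mult (fun y => p * Rpower y (p - 1)) (fun y => hyp01 c (y ^ 2 / 4))).
      -- apply (is_derive_scal (fun y => Rpower y (p - 1))). now apply Rpower_derive.
      -- now apply quarter_square_derive, hyp01_derive.
      -- apply Rmult_comm.
    * apply (is_derive_mult (fun y => Rpower y p) (fun y => y / 2 * dhyp01 c (y ^ 2 / 4))).
      -- now apply Rpower_derive.
      -- apply (is_derive_mult (fun y => y / 2) (fun y => dhyp01 c (y ^ 2 / 4))).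
         ++ instantiate (1 := 1 / 2). auto_derive; [exact I|field].
         ++ now apply quarter_square_derive, dhyp01_derive.
         ++ apply Rmult_comm.
      -- apply Rmult_comm.
  + fold w. change (@eq R (p * ((p - 1) * Rpower x (p - 1 - 1)) * hyp01 c w
       + p * Rpower x (p - 1) * (x / 2 * dhyp01 c w)
       + (p * Rpower x (p - 1) * (x / 2 * dhyp01 c w)
          + Rpower x p * (1 / 2 * dhyp01 c w + x / 2 * (x / 2 * ddhyp01 c w))))
       ((p * (p - 1) / x ^ 2 - 1) * (Rpower x p * hyp01 c w))).
    pose proof (hyp01_ode c w hc) as ho.
    replace (x / 2 * (x / 2 * ddhyp01 c w)) with (w * ddhyp01 c w) by (unfold w; field).
    replace (w * ddhyp01 c w) with (- (c * dhyp01 c w) - hyp01 c w) by lra.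
    rewrite <- (Rpower_add1 x p), <- (Rpower_add1 x (p - 1)) by assumption.
    generalize (hyp01 c w) (dhyp01 c w) (Rpower x (p - 1 - 1)). intros j dj r.
    unfold p. field. lra.
Qed.

Lemma hyp01_0 c : hyp01 c 0 = 1.
Proof. unfold hyp01. now rewrite PSeries_0. Qed.

Lemma scaled_bessel_nonzero c : 0 < c -> exists x0, 0 < x0 /\ scaled_bessel c x0 <> 0.
Proof.
intros hc.
assert (hcont : continuous (fun y => hyp01 c (y ^ 2 / 4)) 0).
{ apply (ex_derive_continuous (fun y => hyp01 c (y ^ 2 / 4))). eexists.
  now apply quarter_square_derive, hyp01_derive. }
assert (hloc : locally 0 (fun y => 0 < hyp01 c (y ^ 2 / 4))).
{ apply (hcont (fun z => 0 < z)). replace (0 ^ 2 / 4) with 0 by field. rewrite hyp01_0.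
  apply open_gt. lra. }
destruct hloc as (d & hd). exists (d / 2). pose proof (cond_pos d) as hdp.
split; [lra|]. unfold scaled_bessel.
assert (0 < hyp01 c ((d / 2) ^ 2 / 4)).
{ apply hd. unfold ball; simpl; unfold AbsRing_ball, abs, minus, plus, opp; simpl.
  rewrite Rabs_pos_eq; lra. }
pose proof (exp_pos ((c - 1 / 2) * ln (d / 2))) as he. fold (Rpower (d / 2) (c - 1 / 2)) in he. nra.
Qed.

(** Termwise form of the fact that [x ^ (alpha+1) J_(alpha+1)] is the primitive
    of [x ^ (alpha+1) J_alpha]. *)
Lemma hyp01_coef_shift c k : 0 < c -> hyp01_coef c k / (c + INR k) = hyp01_coef (c + 1) k / c.
Proof.
intros hc. induction k as [|k IH].
- simpl. now rewrite Rplus_0_r.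
- pose proof (pos_INR k). cbn [hyp01_coef].
  replace (hyp01_coef (c + 1) k) with (hyp01_coef c k / (c + INR k) * c) by (rewrite IH; field;
    lra).
  rewrite S_INR. field. lra.
Qed.

(** The case [beta <= - alpha - 1]: by monotonicity one may take [a = c], where
    [phi] is a multiple of the Bessel function of the next order. *)
Lemma phi_not_nonneg_order c a : 0 < c -> c <= a -> ~ (forall w, 0 < w -> 0 <= phi c a w).
Proof.
intros hc hca hpos.
assert (h2 : forall w, 0 < w -> 0 <= hyp01 (c + 1) w).
{ intros w hw. assert (h : 0 <= phi c c w).
  { eapply Rle_trans; [apply (hpos w hw)|]. now apply phi_monotone. }
  unfold phi in h. rewrite (PSeries_ext _ (PS_scal (/ c) (hyp01_coef (c + 1)))) in h.
  - rewrite PSeries_scal in h. fold (hyp01 (c + 1) w) in h.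
    apply Rmult_le_reg_l with (/ c); [now apply Rinv_0_lt_compat|lra].
  - intros k. unfold phi_coef. rewrite hyp01_coef_shift, PS_scalE by assumption. unfold Rdiv.
    ring. }
destruct (scaled_bessel_nonzero (c + 1)) as (x0 & hx0 & hn); [lra|].
destruct (normal_form_oscillates _ _ _ x0 (scaled_bessel_normal_form (c
  + 1) ltac:(lra)) hx0 hn) as (m & hm & H).
destruct (H 0) as [_ (x & _ & hx & hu)]. unfold scaled_bessel in hu.
assert (0 <= hyp01 (c + 1) (x ^ 2 / 4)).
{ apply h2. apply Rdiv_lt_0_compat; [apply pow_lt|]; lra. }
pose proof (exp_pos ((c + 1 - 1 / 2) * ln x)) as he. fold (Rpower x (c + 1 - 1 / 2)) in he. nra.
Qed.

Lemma phi_primitive_derive c a x : 0 < c -> 0 < a -> 0 < x ->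
  is_derive (fun y => Rpower y (2 * a) * phi c a (y ^ 2 / 4)) x
    (2 * Rpower x (2 * a - 1) * hyp01 c (x ^ 2 / 4)).
Proof.
intros hc ha hx. evar_last.
- apply (is_derive_mult (fun y => Rpower y (2 * a)) (fun y => phi c a (y ^ 2 / 4))).
  + now apply Rpower_derive.
  + now apply quarter_square_derive, phi_derive.
  + apply Rmult_comm.
- pose proof (phi_euler c a (x ^ 2 / 4) hc ha) as he.
  change (@eq R (2 * a * Rpower x (2 * a - 1) * phi c a (x ^ 2 / 4)
    + Rpower x (2 * a) * (x / 2 * dphi c a (x ^ 2 / 4)))
    (2 * Rpower x (2 * a - 1) * hyp01 c (x ^ 2 / 4))).
  rewrite <- he, <- (Rpower_add1 x (2 * a)) by assumption. field.
Qed.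

(** The function [N] below is the integral of [x ^ g u] plus the boundary terms
    of two integrations by parts.  Its derivative is [O(x ^ (g - 2))], which is
    integrable at infinity because [g < 1], so [N] is bounded above and the
    boundary term [- x ^ g u'] decides the sign. *)
Lemma phi_not_nonneg_growth_small c a g : 0 < c -> 0 < g <= 1 / 2 -> 2 * a = c + 1 / 2 + g ->
  ~ (forall w, 0 < w -> 0 <= phi c a w).
Proof.
intros hc hg hag hpos. assert (ha : 0 < a) by lra.
destruct (scaled_bessel_nonzero c hc) as (x0 & hx0 & hn0).
pose proof (scaled_bessel_normal_form c hc) as hn.
set (kappa := (c - 1) ^ 2 - 1 / 4) in hn.
destruct (normal_form_oscillates _ _ _ x0 hn hx0 hn0) as (m & hm & H).
destruct (normal_form_bounded _ _ _ x0 hn hx0) as (U & hU & HU).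
set (N := fun x => Rpower x (2 * a) * phi c a (x ^ 2 / 4) / 2
   + Rpower x g * scaled_bessel_derivative c x - g * (Rpower x (g - 1) * scaled_bessel c x)).
set (k1 := kappa - g * (g - 1)).
assert (hN : forall x, 0 < x -> is_derive N x (k1 * (Rpower x (g - 1 - 1) * scaled_bessel c x))).
{ intros x hx. destruct (hn x hx) as [hu hu1]. unfold N. evar_last.
  - apply (is_derive_minus (fun y => Rpower y (2 * a) * phi c a (y ^ 2 / 4) / 2 + Rpower y g
      * scaled_bessel_derivative c y)
      (fun y => g * (Rpower y (g - 1) * scaled_bessel c y))).
    + apply (is_derive_plus (fun y => Rpower y (2 * a)
        * phi c a (y ^ 2 / 4) / 2) (fun y => Rpower y g * scaled_bessel_derivative c y)).
      * apply (is_derive_ext (fun y => / 2 * (Rpower y (2 * a) * phi c a (y ^ 2 / 4)))).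
        { intros y. apply Rmult_comm. }
        apply (is_derive_scal (fun y => Rpower y (2 * a) * phi c a (y ^ 2 / 4))).
        now apply phi_primitive_derive.
      * apply (is_derive_mult (fun y => Rpower y g) (scaled_bessel_derivative c));
          [now apply Rpower_derive|exact hu1|apply Rmult_comm].
    + apply (is_derive_scal (fun y => Rpower y (g - 1) * scaled_bessel c y)).
      apply (is_derive_mult (fun y => Rpower y (g - 1)) (scaled_bessel c));
        [now apply Rpower_derive|exact hu|apply Rmult_comm].
  - change (@eq R (/ 2 * (2 * Rpower x (2 * a - 1) * hyp01 c (x ^ 2 / 4))
      + (g * Rpower x (g - 1) * scaled_bessel_derivative c x + Rpower x g
          * ((kappa / x ^ 2 - 1) * scaled_bessel c x))
      - g * ((g - 1) * Rpower x (g - 1 - 1) * scaled_bessel c x + Rpower x (g - 1)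
          * scaled_bessel_derivative c x))
      (k1 * (Rpower x (g - 1 - 1) * scaled_bessel c x))).
    replace (/ 2 * (2 * Rpower x (2 * a - 1) * hyp01 c (x ^ 2 / 4)))
      with (Rpower x g * scaled_bessel c x).
    + unfold k1. rewrite <- (Rpower_add1 x g), <- (Rpower_add1 x (g - 1)) by assumption. field. lra.
    + unfold scaled_bessel. rewrite <- Rmult_assoc, <- Rpower_plus.
      replace (g + (c - 1 / 2)) with (2 * a - 1) by lra. field. }
set (x1 := Rmax 1 x0).
assert (hx1 : 1 <= x1) by apply Rmax_l. assert (hx1' : x0 <= x1) by apply Rmax_r.
set (K := Rabs k1 * U).
assert (hK : 0 <= K) by (apply Rmult_le_pos; [apply Rabs_pos|exact hU]).
set (N0 := N x1 + 2 * K * Rpower x1 (- (1 / 2))).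
assert (Hle : forall x, x1 <= x -> N x <= N0).
{ intros x hx. assert (hd : - (N x1 + 2 * K * Rpower x1 (- (1 / 2)))
    <= - (N x + 2 * K * Rpower x (- (1 / 2)))).
  { apply (nondecreasing_of_derive (fun y => - (N y + 2 * K * Rpower y (- (1 / 2))))
      (fun y => - (k1 * (Rpower y (g - 1 - 1) * scaled_bessel c y) + 2 * K * (- (1 / 2)
        * Rpower y (- (1 / 2) - 1))))); [exact hx| |].
    - intros y hy. apply (is_derive_opp (fun y => N y + 2 * K * Rpower y (- (1 / 2)))).
      apply (is_derive_plus N (fun y => 2 * K * Rpower y (- (1 / 2)))); [apply hN; lra|].
      apply (is_derive_scal (fun y => Rpower y (- (1 / 2)))). apply Rpower_derive. lra.
    - intros y hy.
      assert (hb : k1 * (Rpower y (g - 1 - 1) * scaled_bessel c y) <= K * Rpower y (- (1 / 2) - 1)).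
      { eapply Rle_trans; [apply Rle_abs|]. rewrite !Rabs_mult. unfold K.
        rewrite (Rabs_pos_eq (Rpower _ _)) by (apply Rlt_le, exp_pos).
        replace (Rabs k1 * U * Rpower y (- (1 / 2) - 1))
          with (Rabs k1 * (Rpower y (- (1 / 2) - 1) * U)) by ring.
        apply Rmult_le_compat_l; [apply Rabs_pos|].
        apply Rmult_le_compat; [apply Rlt_le, exp_pos|apply Rabs_pos| |apply HU; lra].
        apply Rle_Rpower; lra. }
      lra. }
  pose proof (exp_pos (- (1 / 2) * ln x)) as he. fold (Rpower x (- (1 / 2))) in he.
  unfold N0. nra. }
(* [x ^ g >= Q] makes the boundary term [x ^ g u'] exceed everything else. *)
set (Q := (Rabs N0 + g * U + 1) / m).
assert (hQ : 0 < Q) by (apply Rdiv_lt_0_compat; [pose proof (Rabs_pos N0); nra|exact hm]).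
destruct (H (x1 + Rpower Q (/ g))) as [(x & hx & hxx0 & hum) _].
pose proof (exp_pos (/ g * ln Q)) as heq. fold (Rpower Q (/ g)) in heq.
assert (hxg : Q <= Rpower x g).
{ replace Q with (Rpower (Rpower Q (/ g)) g).
  - apply Rle_Rpower_l; lra.
  - rewrite Rpower_mult, Rinv_l, Rpower_1; [reflexivity|exact hQ|lra]. }
assert (hxm : Rabs N0 + g * U + 1 <= Rpower x g * scaled_bessel_derivative c x).
{ apply Rle_trans with (Q * m); [right; unfold Q; field; lra|].
  apply Rmult_le_compat; lra. }
assert (hgu : g * (Rpower x (g - 1) * scaled_bessel c x) <= g * U).
{ apply Rmult_le_compat_l; [lra|]. eapply Rle_trans; [apply Rle_abs|].
  rewrite Rabs_mult, (Rabs_pos_eq (Rpower _ _)) by (apply Rlt_le, exp_pos).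
  rewrite <- (Rmult_1_l U). apply Rmult_le_compat;
    [apply Rlt_le, exp_pos|apply Rabs_pos| |apply HU; lra].
  apply Rle_trans with (Rpower x 0); [apply Rle_Rpower; lra|rewrite Rpower_O; lra]. }
pose proof (Hle x ltac:(lra)) as hNx. unfold N in hNx at 1.
pose proof (Rle_abs N0).
assert (hF : 0 <= phi c a (x ^ 2 / 4)).
{ apply hpos. apply Rdiv_lt_0_compat; [apply pow_lt|]; lra. }
pose proof (exp_pos (2 * a * ln x)) as hep. fold (Rpower x (2 * a)) in hep.
assert (0 <= Rpower x (2 * a) * phi c a (x ^ 2 / 4)) by (apply Rmult_le_pos; lra).
lra.
Qed.

(** The case [beta < - 1 / 2]: raising [beta] brings the exponent [g] below
    [1 / 2]. *)
Lemma phi_not_nonneg_growth c a : 0 < c -> c + 1 / 2 < 2 * a ->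
  ~ (forall w, 0 < w -> 0 <= phi c a w).
Proof.
intros hc hca hpos.
set (g := Rmin (2 * a - c - 1 / 2) (1 / 2)).
assert (hg : 0 < g <= 1 / 2).
{ unfold g. split; [apply Rmin_glb_lt; lra|apply Rmin_r]. }
assert (hg2 : g <= 2 * a - c - 1 / 2) by apply Rmin_l.
apply (phi_not_nonneg_growth_small c ((c + 1 / 2 + g) / 2) g hc hg ltac:(field)).
intros w hw. eapply Rle_trans; [apply (hpos w hw)|].
apply phi_monotone; auto; lra.
Qed.

(** * Euler's integral *)

Lemma is_RInt_gen_primitive (f F : R -> R) (l0 l1 : R) (Fa Fb : (R -> Prop) -> Prop)
  (HFa : Filter Fa) (HFb : Filter Fb) :
  filterlim F Fa (locally l0) -> filterlim F Fb (locally l1) ->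
  filter_prod Fa Fb (fun ab => is_RInt f (fst ab) (snd ab) (F (snd ab) - F (fst ab))) ->
  is_RInt_gen f Fa Fb (l1 - l0).
Proof.
intros h0 h1 hf P hP.
assert (hlim : filterlim (fun ab : R * R => F (snd ab) - F (fst ab)) (filter_prod Fa Fb) (locally
  (l1 - l0))).
{ eapply (filterlim_comp_2 (fun ab : R * R => F (snd ab)) (fun ab : R * R => F (fst ab)) Rminus).
  - eapply filterlim_comp; [apply filterlim_snd|exact h1].
  - eapply filterlim_comp; [apply filterlim_fst|exact h0].
  - eapply (filterlim_comp_2 fst (fun z : R * R => - snd z) Rplus).
    + apply filterlim_fst.
    + eapply filterlim_comp; [apply filterlim_snd|apply (filterlim_opp l0)].
    + apply (filterlim_plus l1 (- l0)). }
specialize (hlim P hP). unfold filtermap in hlim. unfold filtermapi.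
generalize (filter_and _ _ hf hlim). apply filter_imp. intros ab [H1 H2].
now exists (F (snd ab) - F (fst ab)).
Qed.

Lemma monotone_lim_infty (F : R -> R) (M : R) :
  (forall x y, 0 < x <= y -> F x <= F y) -> (forall x, 0 < x -> F x <= M) ->
  exists l, filterlim F (Rbar_locally p_infty) (locally l) /\ forall x, 0 < x -> F x <= l.
Proof.
intros hinc hM.
destruct (completeness (fun z => exists x, 0 < x /\ z = F x)) as (l & hub & hlub).
- exists M. intros z (x & hx & ->). now apply hM.
- exists (F 1), 1. split; [lra|reflexivity].
- assert (hle : forall x, 0 < x -> F x <= l) by (intros x hx; apply hub; exists x; auto).
  exists l. split; [|exact hle].
  apply filterlim_locally. intros eps. pose proof (cond_pos eps) as he.
  assert (hx : exists x, 0 < x /\ l - eps < F x).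
  { apply Classical_Prop.NNPP. intros hn. assert (l <= l - eps); [|lra].
    apply hlub. intros z (x & hx & ->). apply Rnot_lt_le. intros hlt. apply hn. now exists x. }
  destruct hx as (x0 & hx0 & hxe). exists x0. intros x hx.
  unfold ball; simpl; unfold AbsRing_ball, abs, minus, plus, opp; simpl.
  apply Rabs_def1; [specialize (hle x ltac:(lra)); lra|].
  specialize (hinc x0 x ltac:(lra)). lra.
Qed.

Lemma monotone_lim_0 (F : R -> R) (M : R) :
  (forall x y, 0 < x <= y -> F x <= F y) -> (forall x, 0 < x -> M <= F x) ->
  exists l, filterlim F (at_right 0) (locally l) /\ forall x, 0 < x -> l <= F x.
Proof.
intros hinc hM.
destruct (monotone_lim_infty (fun y => - F (/ y)) (- M)) as (l & hl & hb).
- intros x y hxy. apply Ropp_le_contravar, hinc. split.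
  + apply Rinv_0_lt_compat; lra.
  + apply Rinv_le_contravar; lra.
- intros x hx. apply Ropp_le_contravar, hM, Rinv_0_lt_compat, hx.
- exists (- l). split.
  + eapply filterlim_ext_loc; [|eapply filterlim_comp; [|apply (filterlim_opp l)]].
    2:{ eapply filterlim_comp; [apply filterlim_Rinv_0_right|exact hl]. }
    exists (mkposreal 1 Rlt_0_1). intros y _ hy. unfold opp; simpl.
    rewrite Rinv_inv. ring.
  + intros x hx. specialize (hb (/ x) (Rinv_0_lt_compat _ hx)). simpl in hb.
    rewrite Rinv_inv in hb. lra.
Qed.

Definition euler_integrand (s t : R) : R := Rpower t (s - 1) * exp (- t).

Lemma euler_integrand_continuous s t : 0 < t -> continuous (euler_integrand s) t.
Proof.
intros ht. apply (ex_derive_continuous (euler_integrand s)). unfold euler_integrand. eexists.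
apply (is_derive_mult (fun t => Rpower t (s - 1)) (fun t => exp (- t))).
- now apply Rpower_derive.
- auto_derive; [exact I|reflexivity].
- apply Rmult_comm.
Qed.

Lemma euler_integrand_pos s t : 0 < euler_integrand s t.
Proof. apply Rmult_lt_0_compat; apply exp_pos. Qed.

Lemma euler_integrand_RInt s x y : 0 < x -> 0 < y ->
  is_RInt (euler_integrand s) x y (RInt (euler_integrand s) x y).
Proof.
intros hx hy. apply (RInt_correct (euler_integrand s)), ex_RInt_continuous.
intros z hz. apply euler_integrand_continuous. pose proof (Rmin_glb_lt x y 0 hx hy). lra.
Qed.

Definition euler_primitive (s x : R) : R := RInt (euler_integrand s) 1 x.

Lemma euler_primitive_derive s x : 0 < x -> is_derive (euler_primitive s) x (euler_integrand s x).
Proof.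
intros hx. apply (is_derive_RInt (euler_integrand s) (euler_primitive s) 1).
- exists (mkposreal x hx). intros y hy.
  unfold ball in hy; simpl in hy; unfold AbsRing_ball, abs, minus, plus, opp in hy; simpl in hy.
  apply Rabs_lt_between in hy. apply euler_integrand_RInt; lra.
- now apply euler_integrand_continuous.
Qed.

Lemma euler_primitive_diff s x y : 0 < x -> 0 < y ->
  is_RInt (euler_integrand s) x y (euler_primitive s y - euler_primitive s x).
Proof.
intros hx hy. unfold euler_primitive, Rminus. rewrite Rplus_comm.
apply (is_RInt_Chasles (V := R_NormedModule) (euler_integrand s) x 1 y).
- apply (is_RInt_swap (V := R_NormedModule)), euler_integrand_RInt; lra.
- apply euler_integrand_RInt; lra.
Qed.

(** From [ln y <= y] at [y = t / (2 p)]: the power contributes at most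
    [exp (t / 2)] up to a constant. *)
Lemma euler_integrand_upper s : exists C, 0 < C /\ forall t, 1 <= t ->
  euler_integrand s t <= C * exp (- t / 2).
Proof.
set (p := Rabs s + 1). pose proof (Rabs_pos s) as hs. assert (hp : 1 <= p) by (unfold p; lra).
exists (exp (p * ln (2 * p))). split; [apply exp_pos|]. intros t ht.
unfold euler_integrand, Rpower. rewrite <- !exp_plus.
assert (h1 : ln (t / (2 * p)) <= t / (2 * p)).
{ pose proof (exp_ineq1_le (ln (t / (2 * p)))) as h. rewrite exp_ln in h; [lra|].
  apply Rdiv_lt_0_compat; lra. }
assert (h2 : ln t = ln (t / (2 * p)) + ln (2 * p)).
{ rewrite <- ln_mult; [f_equal; field; lra| |lra]. apply Rdiv_lt_0_compat; lra. }
assert (h0 : 0 <= ln t) by (rewrite <- ln_1; apply Rcomplements.ln_le; lra).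
assert (h3 : (s - 1) * ln t <= p * ln t).
{ apply Rmult_le_compat_r; [exact h0|]. unfold p. pose proof (Rle_abs s). lra. }
assert (h4 : p * ln t <= p * ln (2 * p) + t / 2).
{ rewrite h2, Rmult_plus_distr_l.
  apply (Rmult_le_compat_l p) in h1; [|lra].
  replace (p * (t / (2 * p))) with (t / 2) in h1 by (field; lra). lra. }
assert (h5 : (s - 1) * ln t + - t <= p * ln (2 * p) + - t / 2) by lra.
destruct (Rle_lt_or_eq_dec _ _ h5) as [h6|h6]; [left; now apply exp_increasing|right; now f_equal].
Qed.

Lemma euler_primitive_incr s x y : 0 < x <= y -> euler_primitive s x <= euler_primitive s y.
Proof.
intros hxy. apply nondecreasing_of_derive with (euler_integrand s); [lra| |].
- intros z hz. apply euler_primitive_derive. lra.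
- intros z _. apply Rlt_le, euler_integrand_pos.
Qed.

Lemma euler_primitive_1 s : euler_primitive s 1 = 0.
Proof. exact (RInt_point (V := R_CompleteNormedModule) 1 (euler_integrand s)). Qed.

Lemma euler_primitive_lower s x : 0 < s -> 0 < x -> - / s <= euler_primitive s x.
Proof.
intros hs hx. destruct (Rle_or_lt 1 x) as [h1|h1].
- pose proof (euler_primitive_incr s 1 x ltac:(lra)) as h. rewrite euler_primitive_1 in h.
  pose proof (Rinv_0_lt_compat s hs). lra.
- assert (h : / s * Rpower x s - euler_primitive s x <= / s * Rpower 1 s - euler_primitive s 1).
  { apply (nondecreasing_of_derive (fun y => / s * Rpower y s - euler_primitive s y)
      (fun y => / s * (s * Rpower y (s - 1)) - euler_integrand s y)); [lra| |].
    - intros y hy. apply (is_derive_minus (fun y => / s * Rpower y s) (euler_primitive s)).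
      + apply (is_derive_scal (fun y => Rpower y s)), Rpower_derive. lra.
      + apply euler_primitive_derive. lra.
    - intros y hy. unfold euler_integrand. rewrite <- Rmult_assoc, Rinv_l, Rmult_1_l by lra.
      assert (exp (- y) <= 1).
      { rewrite <- exp_0. left. apply exp_increasing. lra. }
      pose proof (exp_pos ((s - 1) * ln y)) as he. fold (Rpower y (s - 1)) in he. nra. }
  assert (h1s : Rpower 1 s = 1) by (unfold Rpower; rewrite ln_1, Rmult_0_r; apply exp_0).
  rewrite euler_primitive_1, h1s in h.
  pose proof (exp_pos (s * ln x)) as he. fold (Rpower x s) in he.
  pose proof (Rinv_0_lt_compat s hs). nra.
Qed.

Lemma euler_primitive_upper s : exists M, forall x, 0 < x -> euler_primitive s x <= M.
Proof.
destruct (euler_integrand_upper s) as (C & hC & H). exists (2 * C).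
assert (h : forall x, 1 <= x -> euler_primitive s x <= 2 * C).
{ intros x hx.
  assert (h : - 2 * C * exp (- 1 / 2) - euler_primitive s 1
    <= - 2 * C * exp (- x / 2) - euler_primitive s x).
  { apply (nondecreasing_of_derive (fun y => - 2 * C * exp (- y / 2) - euler_primitive s y)
      (fun y => C * exp (- y / 2) - euler_integrand s y)); [lra| |].
    - intros y hy. apply (is_derive_minus (fun y => - 2 * C * exp (- y / 2)) (euler_primitive s)).
      + auto_derive; [exact I|]. unfold Rdiv. field.
      + apply euler_primitive_derive. lra.
    - intros y hy. specialize (H y ltac:(lra)). lra. }
  rewrite euler_primitive_1 in h. pose proof (exp_pos (- x / 2)).
  assert (exp (- 1 / 2) <= 1) by (rewrite <- exp_0; left; apply exp_increasing; lra). nra. }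
intros x hx. destruct (Rle_or_lt 1 x) as [h1|h1]; [now apply h|].
pose proof (euler_primitive_incr s x 1 ltac:(lra)). pose proof (h 1 ltac:(lra)). lra.
Qed.

Lemma near_endpoints (Q : R -> R -> Prop) :
  (forall x y, 0 < x -> 0 < y -> Q x y) ->
  filter_prod (at_right 0) (Rbar_locally p_infty) (fun ab => Q (fst ab) (snd ab)).
Proof.
intros H. apply Filter_prod with (fun x => 0 < x) (fun y => 0 < y).
- exists (mkposreal 1 Rlt_0_1). now intros y _ hy.
- now exists 0.
- exact H.
Qed.

Lemma Gamma_exists s : 0 < s -> exists l, 0 < l /\
  is_RInt_gen (euler_integrand s) (at_right 0) (Rbar_locally p_infty) l.
Proof.
intros hs. destruct (euler_primitive_upper s) as (M & HM).
destruct (monotone_lim_infty (euler_primitive s) M (euler_primitive_incr s) HM) as (l1 & hl1 & hb1).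
destruct (monotone_lim_0 (euler_primitive s) (- / s) (euler_primitive_incr s)) as (l0 & hl0 & hb0).
{ intros x hx. now apply euler_primitive_lower. }
exists (l1 - l0). split.
- destruct (MVT_cor2 (euler_primitive s) (euler_integrand s) 1 2) as (c & hc & _); [lra| |].
  + intros c hc. apply is_derive_Reals, euler_primitive_derive. lra.
  + pose proof (euler_integrand_pos s c). specialize (hb1 2 ltac:(lra)).
    specialize (hb0 1 ltac:(lra)). lra.
- apply is_RInt_gen_primitive with (euler_primitive s); try apply _; auto.
  apply (near_endpoints (fun x y => is_RInt (euler_integrand s) x y (euler_primitive s y -
    euler_primitive s x))).
  intros x y. apply euler_primitive_diff.
Qed.

Lemma Gamma_correct s : 0 < s ->
  is_RInt_gen (euler_integrand s) (at_right 0) (Rbar_locally p_infty) (Gamma s).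
Proof.
intros hs. destruct (Gamma_exists s hs) as (l & _ & hl).
unfold Gamma. apply (RInt_gen_correct (V := R_CompleteNormedModule)). now exists l.
Qed.

Lemma Gamma_pos s : 0 < s -> 0 < Gamma s.
Proof.
intros hs. destruct (Gamma_exists s hs) as (l & hl0 & hl).
unfold Gamma. fold (euler_integrand s). now rewrite (is_RInt_gen_unique (V :=
  R_CompleteNormedModule) (euler_integrand s) l hl).
Qed.

(** Integration by parts: [- t ^ s exp (- t)] vanishes at both ends. *)
Lemma Gamma_succ s : 0 < s -> Gamma (s + 1) = s * Gamma s.
Proof.
intros hs.
set (F := fun t => - (Rpower t s * exp (- t))).
set (f := fun t => minus (euler_integrand (s + 1) t) (scal s (euler_integrand s t))).
assert (hF : forall t, 0 < t -> is_derive F t (f t)).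
{ intros t ht. evar_last.
  - apply (is_derive_opp (fun t => Rpower t s * exp (- t))).
    apply (is_derive_mult (fun t => Rpower t s) (fun t => exp (- t))).
    + now apply Rpower_derive.
    + instantiate (1 := - exp (- t)). auto_derive; [exact I|ring].
    + apply Rmult_comm.
  - unfold f, euler_integrand. replace (s + 1 - 1) with s by ring.
    change (@eq R (- (s * Rpower t (s - 1) * exp (- t) + Rpower t s * - exp (- t)))
      (Rpower t s * exp (- t) - s * (Rpower t (s - 1) * exp (- t)))). ring. }
assert (h1 : is_RInt_gen f (at_right 0) (Rbar_locally p_infty) (minus (Gamma (s
  + 1)) (scal s (Gamma s)))).
{ refine (@is_RInt_gen_minus R_NormedModule _ _ _ _ (euler_integrand (s
    + 1)) (fun t => scal s (euler_integrand s t)) _ _ _ _).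
  - apply Gamma_correct. lra.
  - refine (@is_RInt_gen_scal R_NormedModule _ _ _ _ (euler_integrand s) s _ _).
    now apply Gamma_correct. }
assert (h2 : is_RInt_gen f (at_right 0) (Rbar_locally p_infty) (0 - 0)).
{ apply is_RInt_gen_primitive with F; try apply _.
  - replace 0 with (- (0 * exp (- 0))) at 2 by ring. unfold F.
    eapply filterlim_comp; [|apply (filterlim_opp (0 * exp (- 0)))].
    eapply (filterlim_comp_2 (fun t => Rpower t s) (fun t => exp (- t)) Rmult).
    + now apply Rpower_lim_0.
    + eapply filterlim_filter_le_1; [apply filter_le_within|].
      apply (ex_derive_continuous (fun t => exp (- t)) 0). auto_derive. exact I.
    + apply (filterlim_mult (K := R_AbsRing) 0 (exp (- 0))).
  - destruct (euler_integrand_upper (s + 1)) as (C & hC & HC).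
    apply filterlim_locally. intros eps. pose proof (cond_pos eps) as he.
    exists (Rmax 1 (2 * ln (2 * C / eps))). intros t ht.
    pose proof (Rmax_l 1 (2 * ln (2 * C / eps))). pose proof (Rmax_r 1 (2 * ln (2 * C / eps))).
    specialize (HC t ltac:(lra)). pose proof (euler_integrand_pos (s + 1) t) as hp.
    unfold euler_integrand in HC, hp. replace (s + 1 - 1) with s in HC, hp by ring.
    unfold ball; simpl; unfold AbsRing_ball, abs, minus, plus, opp; simpl. unfold F.
    rewrite Ropp_0, Rplus_0_r, Rabs_Ropp, Rabs_pos_eq by lra.
    eapply Rle_lt_trans; [exact HC|].
    assert (hlt : exp (- t / 2) < eps / (2 * C)).
    { replace (eps / (2 * C)) with (exp (- ln (2 * C / eps))).
      - apply exp_increasing. lra.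
      - rewrite exp_Ropp, exp_ln by (apply Rdiv_lt_0_compat; lra). field. lra. }
    apply (Rmult_lt_compat_l C) in hlt; [|exact hC].
    replace (C * (eps / (2 * C))) with (eps / 2) in hlt by (field; lra). lra.
  - apply (near_endpoints (fun x y => is_RInt f x y (F y - F x))). intros x y hx hy.
    apply (is_RInt_derive F f).
    + intros z hz. apply hF. pose proof (Rmin_glb_lt x y 0 hx hy). lra.
    + intros z hz. pose proof (Rmin_glb_lt x y 0 hx hy). unfold f.
      apply (continuous_minus (euler_integrand (s + 1)) (fun t => scal s (euler_integrand s t))).
      * apply euler_integrand_continuous. lra.
      * apply (continuous_scal_r s (euler_integrand s)). apply euler_integrand_continuous. lra. }
assert (h3 : minus (Gamma (s + 1)) (scal s (Gamma s)) = 0 - 0).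
{ exact (eq_trans (eq_sym (is_RInt_gen_unique (V := R_CompleteNormedModule) _ _ h1))
  (is_RInt_gen_unique (V := R_CompleteNormedModule) _ _ h2)). }
unfold minus, plus, opp, scal in h3; simpl in h3. unfold mult in h3; simpl in h3. lra.
Qed.

(** * The Bessel integral *)

Lemma Gamma_hyp01_coef s k : 0 < s ->
  (-1) ^ k / (INR (fact k) * Gamma (INR k + s)) = hyp01_coef s k / Gamma s.
Proof.
intros hs. pose proof (Gamma_pos s hs) as hg. induction k as [|k IH].
- simpl. rewrite Rplus_0_l. field. lra.
- pose proof (pos_INR k). pose proof (Gamma_pos (INR k + s) ltac:(lra)) as hgk.
  rewrite S_INR. replace (INR k + 1 + s) with (INR k + s + 1) by ring.
  rewrite Gamma_succ, fact_simpl, mult_INR, S_INR by lra. cbn [hyp01_coef pow].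
  replace (- / ((s + INR k) * (INR k + 1)) * hyp01_coef s k / Gamma s)
    with (- / ((s + INR k) * (INR k + 1)) * (hyp01_coef s k / Gamma s)) by (unfold Rdiv; ring).
  rewrite <- IH. field. repeat split; try lra. apply INR_fact_neq_0.
Qed.

Lemma BesselJ_hyp01 al x : -1 < al -> 0 < x ->
  BesselJ al x = Rpower (x / 2) al / Gamma (al + 1) * hyp01 (al + 1) (x ^ 2 / 4).
Proof.
intros hal hx. unfold BesselJ, hyp01, PSeries. rewrite <- Series_scal_l.
apply Series_ext. intros k.
replace (INR k + al + 1) with (INR k + (al + 1)) by ring. rewrite Gamma_hyp01_coef by lra.
assert (hp : Rpower (x / 2) (2 * INR k + al) = Rpower (x / 2) al * (x ^ 2 / 4) ^ k).
{ rewrite Rplus_comm, Rpower_plus. f_equal.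
  replace (2 * INR k) with (INR (2 * k)) by (rewrite mult_INR; reflexivity).
  rewrite Rpower_pow by lra. rewrite pow_mult. f_equal. field. }
rewrite hp. unfold Rdiv. ring.
Qed.

Lemma psi_phi al be x : -1 < al -> be < al + 1 -> 0 < x ->
  psi al be x = Rpower 2 (- al) / (2 * Gamma (al + 1))
    * (Rpower x (al - be + 1) * phi (al + 1) ((al - be + 1) / 2) (x ^ 2 / 4)).
Proof.
intros hal hbe hx. set (a := (al - be + 1) / 2).
assert (ha : 0 < a) by (unfold a; lra). assert (hc : 0 < al + 1) by lra.
pose proof (Gamma_pos (al + 1) hc) as hg.
set (C := Rpower 2 (- al) / (2 * Gamma (al + 1))).
replace (al - be + 1) with (2 * a) by (unfold a; field).
set (P := fun y => Rpower y (2 * a) * phi (al + 1) a (y ^ 2 / 4)).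
set (p := fun y => C * (2 * Rpower y (2 * a - 1) * hyp01 (al + 1) (y ^ 2 / 4))).
change (psi al be x = C * P x).
assert (hp : forall y, 0 < y -> Rpower y (- be) * BesselJ al y = p y).
{ intros y hy. rewrite BesselJ_hyp01 by assumption. unfold p, C.
  replace (Rpower (y / 2) al) with (Rpower y al * Rpower 2 (- al)).
  2:{ rewrite Rpower_Ropp. unfold Rdiv. rewrite <- Rpower_mult_distr by lra. f_equal.
      rewrite <- Rpower_Ropp. unfold Rpower. rewrite ln_Rinv by lra. f_equal. ring. }
  replace (2 * a - 1) with (- be + al) by (unfold a; field). rewrite Rpower_plus. field. lra. }
unfold psi. apply (is_RInt_gen_unique (V := R_CompleteNormedModule)).
replace (C * P x) with (C * P x - 0) by ring.
apply is_RInt_gen_primitive with (fun y => C * P y); try apply _.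
- replace 0 with (C * (0 * phi (al + 1) a (0 ^ 2 / 4))) at 2 by ring.
  eapply filterlim_comp; [|apply (filterlim_scal_r (V := R_NormedModule) C (0 * phi (al
    + 1) a (0 ^ 2 / 4)))].
  eapply (filterlim_comp_2 (fun y => Rpower y (2 * a)) (fun y => phi (al + 1) a (y ^ 2 / 4)) Rmult).
  + apply Rpower_lim_0. lra.
  + eapply filterlim_filter_le_1; [apply filter_le_within|].
    apply (ex_derive_continuous (fun y => phi (al + 1) a (y ^ 2 / 4)) 0).
    eexists. now apply quarter_square_derive, phi_derive.
  + apply (filterlim_mult (K := R_AbsRing) 0 (phi (al + 1) a (0 ^ 2 / 4))).
- intros Q hQ. unfold filtermap, at_point. now apply locally_singleton.
- apply Filter_prod with (fun y => 0 < y) (fun y => y = x).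
  + exists (mkposreal 1 Rlt_0_1). now intros y _ hy.
  + reflexivity.
  + intros y z hy hz. simpl. subst z. pose proof (Rmin_glb_lt y x 0 hy hx) as hm.
    apply is_RInt_ext with p.
    * intros t ht. symmetry. apply hp. lra.
    * apply (is_RInt_derive (fun y => C * P y) p).
      -- intros t ht. apply (is_derive_scal P). apply phi_primitive_derive; lra.
      -- intros t ht. apply (ex_derive_continuous p). unfold p.
         apply ex_derive_scal. apply (ex_derive_mult (fun y => 2 * Rpower y (2
           * a - 1)) (fun y => hyp01 (al + 1) (y ^ 2 / 4))).
         ++ apply ex_derive_scal. eexists. apply Rpower_derive. lra.
         ++ eexists. now apply quarter_square_derive, hyp01_derive.
Qed.

Lemma psi_sign al be : -1 < al -> be < al + 1 -> exists C : R -> R, forall x, 0 < x ->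
  0 < C x /\ psi al be x = C x * phi (al + 1) ((al - be + 1) / 2) (x ^ 2 / 4).
Proof.
intros hal hbe.
exists (fun x => Rpower 2 (- al) / (2 * Gamma (al + 1)) * Rpower x (al - be + 1)). intros x hx.
pose proof (Gamma_pos (al + 1) ltac:(lra)). split.
- apply Rmult_lt_0_compat; [apply Rdiv_lt_0_compat; [|lra]|]; apply exp_pos.
- rewrite psi_phi by assumption. ring.
Qed.

Theorem theorem5p1 (alpha beta : R)
    (halpha : -1 < alpha) (hbeta : beta < alpha + 1) :
  ((forall x : R, 0 < x -> 0 <= psi alpha beta x) ->
     (- alpha - 1 < beta < alpha + 1) /\ - (1 / 2) <= beta)
  /\
  (Pstar (alpha, beta) ->
     (forall x : R, 0 < x -> 0 <= psi alpha beta x) /\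
     ((alpha, beta) <> (1 / 2, - (1 / 2)) ->
        forall x : R, 0 < x -> 0 < psi alpha beta x)).
Proof.
destruct (psi_sign alpha beta halpha hbeta) as (C & HC).
set (a := (alpha - beta + 1) / 2) in HC.
assert (ha : 0 < a) by (unfold a; lra). assert (hc : 0 < alpha + 1) by lra.
split.
- intros hpsi.
  assert (hphi : forall w, 0 < w -> 0 <= phi (alpha + 1) a w).
  { intros w hw. set (x := 2 * sqrt w).
    assert (hx : 0 < x) by (pose proof (sqrt_lt_R0 w hw); unfold x; lra).
    assert (hxw : x ^ 2 / 4 = w).
    { unfold x. transitivity (sqrt w * sqrt w); [field|apply sqrt_sqrt; lra]. }
    destruct (HC x hx) as [hC e]. specialize (hpsi x hx). rewrite e, hxw in hpsi. nra. }
  assert (h1 : - alpha - 1 < beta).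
  { apply Rnot_le_lt. intros h. apply (phi_not_nonneg_order (alpha + 1) a hc); [unfold a;
      lra|exact hphi]. }
  assert (h2 : - (1 / 2) <= beta).
  { apply Rnot_lt_le. intros h. apply (phi_not_nonneg_growth (alpha + 1) a hc); [unfold a;
      lra|exact hphi]. }
  lra.
- intros (_ & hb & _).
  pose proof (Rmax_l (- (1 / 2)) (- (1 / 3) * (alpha + 1))).
  pose proof (Rmax_r (- (1 / 2)) (- (1 / 3) * (alpha + 1))).
  (* The squares have the argument [t = x ^ 2 / 16], that is, they are those of
     Bessel functions at [x / 2]. *)
  set (nu := alpha / 2 + 1 / 4).
  assert (hgood : positivity_region nu a) by (unfold positivity_region, nu, a; lra).
  assert (hnu : alpha + 1 = 2 * nu + 1 / 2) by (unfold nu; field).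
  assert (hw : forall x, x ^ 2 / 4 = 4 * (x ^ 2 / 16)) by (intros x; field).
  split.
  + intros x hx. destruct (HC x hx) as [hC ->]. rewrite hnu, hw.
    apply Rmult_le_pos; [lra|]. apply phi_nonneg; [exact hgood|nra].
  + intros hne x hx. destruct (HC x hx) as [hC ->]. rewrite hnu, hw.
    apply Rmult_lt_0_compat; [exact hC|]. apply phi_pos; [exact hgood| |nra].
    intros [e1 e2]. apply hne. unfold nu in e1. unfold a in e2. f_equal; lra.
Qed.
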